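(* Let $H(\mathbb C)$ be the Fréchet space of entire functions with the topology of uniform convergence on compact sets, let $\phi$ be an entire function, and let $C_\phi:H(\mathbb C)\to H(\mathbb C)$, $C_\phi f=f\circ\phi$. Then $C_\phi$ is recurrent if and only if $\phi(z)=az+b$ for some $a,b\in\mathbb C$ with $|a|=1$.
   Context: A continuous linear operator $T$ on a Fréchet space $Y$ is recurrent if for every non-empty open $U\subset Y$ there is a positive integer $k$ with $U\cap T^{-k}(U)\neq\emptyset$. *)

(* Defs.v *)
From Stdlib Require Import Reals.
From Coquelicot Require Import Coquelicot.
Open Scope R_scope.

Definition entire (f : C -> C) : Prop :=
  forall z : C, ex_derive (K := C_AbsRing) (V := C_NormedModule) f z.

(* Open subsets of H(C) with the topology of uniform convergence on compact
   sets, given by the seminorms p_R(f) = sup_{|z| <= R} |f z|.  A subset of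
   H(C) is represented by a predicate on C -> C (only its entire members
   matter).  U is open iff every entire f in U has a basic neighbourhood
   { g entire | p_R(g - f) <= eps } contained in U. *)
Definition H_open (U : (C -> C) -> Prop) : Prop :=
  forall f, entire f -> U f ->
    exists (rad eps : R), 0 < eps /\
      forall g, entire g ->
        (forall z : C, Cmod z <= rad -> Cmod (Cminus (g z) (f z)) <= eps) ->
        U g.

Definition comp_op (phi : C -> C) (f : C -> C) : C -> C := fun z => f (phi z).

Definition recurrent_comp (phi : C -> C) : Prop :=
  forall U : (C -> C) -> Prop, H_open U -> (exists f, entire f /\ U f) ->
    exists k : nat, (1 <= k)%nat /\
      exists f, entire f /\ U f /\ U (Nat.iter k (comp_op phi) f).

(* Main.v *)
(* Let [phi] be such that [C_phi] is recurrent.  Applied to the identity function,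
   recurrence gives entire [g] with both [g] and [g o phi^k] close to the identity
   on a disc, so [phi] is injective.  An injective entire function is affine: if
   [psi] is its normalization at a point with non-zero derivative ([psi 0 = 0]),
   then [psi] stays away from [0] outside the unit disc, hence [z^2 / psi z] is
   entire of quadratic growth, hence a quadratic polynomial, and this forces
   [psi] to be linear.  If [phi] has a multiplier of modulus different from 1,
   then some point of the unit circle around the fixed point and its image under
   [phi^k] or [phi^-k] are too far apart for [g] to exist.
   Conversely, powers of a rotation come arbitrarily close to the identity, and
   for a translation by [b] one glues [f] near [0] to [f (z - k b)] near [k b],
   using iterates of a polynomial with superattracting fixed points [0] and [1].
   Cauchy's formula is obtained from Goursat's theorem with diamonds (vertices
   [w +- r], [w +- i r]) as contours. *)
Require Import Defs.
From Stdlib Require Import Reals Lra Lia IndefiniteDescription List FinFun.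
From Coquelicot Require Import Coquelicot.
Open Scope R_scope.

(** * Complex differentiability *)

Notation C_derivable f z := (ex_derive (K := C_AbsRing) (V := C_NormedModule) f z).
Notation is_C_derive f z l := (is_derive (K := C_AbsRing) (V := C_NormedModule) f z l).

(** The epsilon-delta form in the modulus, on which the explicit estimates below are built. *)
Lemma is_C_derive_iff (f : C -> C) (z l : C) :
  is_C_derive f z l <->
  forall eps, 0 < eps -> exists d, 0 < d /\ forall y, Cmod (y - z) < d ->
    Cmod (f y - f z - (y - z) * l) <= eps * Cmod (y - z).
Proof.
split.
- intros [_ H] eps Heps.
  destruct (H z (fun P HP => HP) (mkposreal eps Heps)) as [d Hd].
  exists d; split; [apply cond_pos|]. intros y Hy.
  exact (Hd y Hy).
- intros H. split; [apply is_linear_scal_l|].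
  intros x Hx eps.
  (* Differentiability along a filter speaks of every limit [x] of [locally z]; limits are unique,
     so [x] is [z]. *)
  replace x with z.
  2:{ apply (is_filter_lim_locally_unique (K:=C_AbsRing)(V:=AbsRing_NormedModule C_AbsRing)). exact Hx. }
  destruct (H eps (cond_pos eps)) as [d [Hd1 Hd2]].
  exists (mkposreal d Hd1). intros y Hy. exact (Hd2 y Hy).
Qed.

(* The two normed modules on [C] carry uniform structures that are not convertible,
   and Coquelicot's product and chain rules need the second one. *)
Lemma is_C_derive_ring (f : C -> C) (z l : C) :
  is_C_derive f z l <-> is_derive (K := C_AbsRing) (V := AbsRing_NormedModule C_AbsRing) f z l.
Proof.
rewrite is_C_derive_iff. split.
- intros H. split; [apply is_linear_scal_l|].
  intros x Hx eps.
  replace x with z.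
  2:{ apply (is_filter_lim_locally_unique (K:=C_AbsRing)(V:=AbsRing_NormedModule C_AbsRing)). exact Hx. }
  destruct (H eps (cond_pos eps)) as [d [Hd1 Hd2]].
  exists (mkposreal d Hd1). intros y Hy. exact (Hd2 y Hy).
- intros [_ H] eps Heps.
  destruct (H z (fun P HP => HP) (mkposreal eps Heps)) as [d Hd].
  exists d; split; [apply cond_pos|]. intros y Hy.
  exact (Hd y Hy).
Qed.

Lemma is_C_derive_mult (f g : C -> C) (z df dg : C) :
  is_C_derive f z df -> is_C_derive g z dg ->
  is_C_derive (fun t => f t * g t)%C z (df * g z + f z * dg)%C.
Proof.
rewrite !is_C_derive_ring. intros Hf Hg.
exact (is_derive_mult (K := C_AbsRing) f g z df dg Hf Hg Cmult_comm).
Qed.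

Lemma is_C_derive_comp (f g : C -> C) (z df dg : C) :
  is_C_derive f (g z) df -> is_C_derive g z dg ->
  is_C_derive (fun t => f (g t)) z (dg * df)%C.
Proof.
rewrite !is_C_derive_ring. intros Hf Hg.
exact (is_derive_comp (K := C_AbsRing) (V := AbsRing_NormedModule C_AbsRing) f g z df dg Hf Hg).
Qed.

Lemma Cmod_triangle_minus (x y : C) : Cmod (x - y) <= Cmod x + Cmod y.
Proof. unfold Cminus. rewrite <- (Cmod_opp y). apply Cmod_triangle. Qed.

Lemma Cmod_minus_sym (x y : C) : Cmod (x - y) = Cmod (y - x).
Proof. rewrite <- Cmod_opp. f_equal. ring. Qed.

Lemma Cmod_triangle_rev (x y : C) : Cmod x - Cmod y <= Cmod (x - y).
Proof.
assert (H := Cmod_triangle (x - y) y).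
replace (x - y + y)%C with x in H by ring. lra.
Qed.

Lemma Cmod_minus_triangle (x y z : C) : Cmod (x - z) <= Cmod (x - y) + Cmod (y - z).
Proof. replace (x - z)%C with ((x - y) + (y - z))%C by ring. apply Cmod_triangle. Qed.

Lemma Cmod_minus_0 (x y : C) : Cmod (x - y) = 0 -> x = y.
Proof. intros H. apply Cmod_eq_0 in H. now apply Ceq_minus. Qed.

(** The error of the linear approximation is [(y - z) ^ 2 / (y * z ^ 2)], which is quadratic in
    [y - z] because [y] stays away from [0]. *)
Lemma is_C_derive_inv (z : C) : z <> 0 -> is_C_derive Cinv z (- / (z * z))%C.
Proof.
intros Hz. apply is_C_derive_iff. intros eps Heps.
assert (Hm : 0 < Cmod z) by now apply Cmod_gt_0.
assert (Hm3 : 0 < Cmod z ^ 3) by now apply pow_lt.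
(* The first bound gives [Cmod y >= Cmod z / 2]; the second absorbs the remaining factors into
   [eps]. *)
exists (Rmin (Cmod z / 2) (eps * Cmod z ^ 3 / 2)). split.
{ apply Rmin_glb_lt; [lra|]. apply Rmult_lt_0_compat; [|lra]. now apply Rmult_lt_0_compat. }
intros y Hy.
assert (H1 := Rlt_le_trans _ _ _ Hy (Rmin_l _ _)).
assert (H2 := Rlt_le_trans _ _ _ Hy (Rmin_r _ _)).
assert (Hym : Cmod z / 2 <= Cmod y).
{ assert (H := Cmod_triangle_rev z y). rewrite (Cmod_minus_sym z y) in H. lra. }
assert (Hy0 : y <> 0) by (apply Cmod_gt_0; lra).
replace (/ y - / z - (y - z) * - / (z * z))%C
  with ((y - z) * ((y - z) / (y * (z * z))))%C by (field; auto).
rewrite Cmod_mult, Rmult_comm. apply Rmult_le_compat_r; [apply Cmod_ge_0|].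
rewrite Cmod_div by (repeat apply Cmult_neq_0; auto). rewrite !Cmod_mult.
apply Rle_div_l; [apply Rmult_lt_0_compat; [lra|]; nra|].
apply Rle_trans with (eps * Cmod z ^ 3 / 2); [lra|].
replace (eps * Cmod z ^ 3 / 2) with (eps * (Cmod z / 2 * (Cmod z * Cmod z))) by field.
apply Rmult_le_compat_l; [lra|]. apply Rmult_le_compat_r; [nra|lra].
Qed.

Lemma C_derivable_const (c z : C) : C_derivable (fun _ => c) z.
Proof. apply ex_derive_const. Qed.

Lemma is_C_derive_id (z : C) : is_C_derive (fun t => t) z (RtoC 1).
Proof. apply is_C_derive_ring, (is_derive_id (K := C_AbsRing)). Qed.

Lemma C_derivable_id (z : C) : C_derivable (fun t => t) z.
Proof. exists (RtoC 1). apply is_C_derive_id. Qed.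

Lemma C_derivable_plus (f g : C -> C) (z : C) :
  C_derivable f z -> C_derivable g z -> C_derivable (fun t => f t + g t)%C z.
Proof. apply (ex_derive_plus (K := C_AbsRing) (V := C_NormedModule)). Qed.

Lemma C_derivable_minus (f g : C -> C) (z : C) :
  C_derivable f z -> C_derivable g z -> C_derivable (fun t => f t - g t)%C z.
Proof. apply (ex_derive_minus (K := C_AbsRing) (V := C_NormedModule)). Qed.

Lemma C_derivable_mult (f g : C -> C) (z : C) :
  C_derivable f z -> C_derivable g z -> C_derivable (fun t => f t * g t)%C z.
Proof. intros [l Hl] [m Hm]. eexists. apply is_C_derive_mult; eassumption. Qed.

Lemma C_derivable_comp (f g : C -> C) (z : C) :
  C_derivable f (g z) -> C_derivable g z -> C_derivable (fun t => f (g t)) z.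
Proof. intros [l Hl] [m Hm]. eexists. apply is_C_derive_comp; eassumption. Qed.

Lemma C_derivable_inv (f : C -> C) (z : C) :
  f z <> 0 -> C_derivable f z -> C_derivable (fun t => / f t)%C z.
Proof.
intros H0 H. apply (C_derivable_comp Cinv); [|exact H].
eexists. now apply is_C_derive_inv.
Qed.

Lemma C_derivable_div (f g : C -> C) (z : C) :
  g z <> 0 -> C_derivable f z -> C_derivable g z -> C_derivable (fun t => f t / g t)%C z.
Proof. intros H0 Hf Hg. apply C_derivable_mult; [exact Hf|]. now apply C_derivable_inv. Qed.

(** Differentiates by structure. Leaves and non-zero denominators not found among the hypotheses
    remain as goals; the [Cmult ?a] case catches an eta-reduced product. *)
Ltac C_derive_tac :=
  lazymatch goal with
  | |- ex_derive (fun _ => ?c) _ => apply C_derivable_const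
  | |- ex_derive (fun t => t) _ => apply C_derivable_id
  | |- ex_derive (Cmult ?a) _ =>
      apply (C_derivable_mult (fun _ => a) (fun t => t)); C_derive_tac
  | |- ex_derive (fun t => Cplus _ _) _ => apply C_derivable_plus; C_derive_tac
  | |- ex_derive (fun t => Cminus _ _) _ => apply C_derivable_minus; C_derive_tac
  | |- ex_derive (fun t => Cmult _ _) _ => apply C_derivable_mult; C_derive_tac
  | |- ex_derive (fun t => Cdiv _ _) _ => apply C_derivable_div; [ try assumption | C_derive_tac | C_derive_tac ]
  | |- ex_derive (fun t => Cinv _) _ => apply C_derivable_inv; [ try assumption | C_derive_tac ]
  | |- _ => try assumption
  end.

Definition C_continuous (f : C -> C) (z : C) : Prop :=
  forall eps, 0 < eps -> exists d, 0 < d /\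
    forall y, Cmod (y - z) < d -> Cmod (f y - f z) < eps.

Lemma is_C_derive_lipschitz (f : C -> C) (z l : C) :
  is_C_derive f z l -> exists d, 0 < d /\
    forall y, Cmod (y - z) < d -> Cmod (f y - f z) <= (1 + Cmod l) * Cmod (y - z).
Proof.
intros H. destruct (proj1 (is_C_derive_iff f z l) H 1 Rlt_0_1) as [d [Hd Hf]].
exists d; split; [exact Hd|]. intros y Hy.
replace (f y - f z)%C with ((f y - f z - (y - z) * l) + (y - z) * l)%C by ring.
eapply Rle_trans; [apply Cmod_triangle|]. rewrite Cmod_mult.
specialize (Hf y Hy). lra.
Qed.

Lemma C_derivable_continuous (f : C -> C) (z : C) : C_derivable f z -> C_continuous f z.
Proof.
intros [l Hl]. destruct (is_C_derive_lipschitz f z l Hl) as [d [Hd Hf]].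
intros eps Heps. assert (Hl0 := Cmod_ge_0 l).
exists (Rmin d (eps / (1 + Cmod l))). split.
{ apply Rmin_glb_lt; [exact Hd|]. apply Rdiv_lt_0_compat; lra. }
intros y Hy.
assert (H1 := Rlt_le_trans _ _ _ Hy (Rmin_l _ _)).
assert (H2 := Rlt_le_trans _ _ _ Hy (Rmin_r _ _)).
eapply Rle_lt_trans; [exact (Hf y H1)|].
rewrite Rmult_comm. apply Rlt_div_r; [lra|exact H2].
Qed.

(** * Integrals along segments *)

Definition seg_point (P Q : C) (t : R) : C := (P + RtoC t * (Q - P))%C.

Definition C_RInt (f : R -> C) (a b : R) : C := RInt (V := C_R_CompleteNormedModule) f a b.

(** The contour integral along the segment, with its constant velocity [Q - P] taken out. *)
Definition seg (f : C -> C) (P Q : C) : C :=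
  ((Q - P) * C_RInt (fun t => f (seg_point P Q t)) 0 1)%C.

Definition continuous_on_seg (f : C -> C) (P Q : C) : Prop :=
  forall t, 0 <= t <= 1 -> C_continuous f (seg_point P Q t).

Lemma seg_point_minus (P Q : C) (s t : R) :
  (seg_point P Q s - seg_point P Q t)%C = (RtoC (s - t) * (Q - P))%C.
Proof. unfold seg_point. rewrite RtoC_minus. ring. Qed.

Lemma continuous_seg_point (f : C -> C) (P Q : C) (t : R) :
  C_continuous f (seg_point P Q t) ->
  continuous (T := R_UniformSpace) (U := C_R_CompleteNormedModule)
    (fun s => f (seg_point P Q s)) t.
Proof.
intros Hf.
apply (filterlim_locally (U := C_R_CompleteNormedModule) (F := locally (T := R_UniformSpace) t)). intros eps.
destruct (Hf eps (cond_pos eps)) as [d [Hd H]].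
assert (HD := Cmod_ge_0 (Q - P)).
(* The summand [1] covers a degenerate segment [P = Q]. *)
assert (Hd' : 0 < d / (1 + Cmod (Q - P))) by (apply Rdiv_lt_0_compat; lra).
exists (mkposreal _ Hd'). intros s Hs.
change (Rabs (s - t) < d / (1 + Cmod (Q - P))) in Hs.
apply Rlt_div_r in Hs; [|lra].
assert (H1 : Cmod (f (seg_point P Q s) - f (seg_point P Q t)) < eps).
{ apply H. rewrite seg_point_minus, Cmod_mult, Cmod_R.
  assert (H0 := Rabs_pos (s - t)). nra. }
assert (H2 := Rmax_Cmod (f (seg_point P Q s) - f (seg_point P Q t))%C).
split; (eapply Rle_lt_trans; [|exact H1]); (eapply Rle_trans; [|exact H2]).
- apply Rmax_l.
- apply Rmax_r.
Qed.

Lemma is_C_RInt_seg (f : C -> C) (P Q : C) :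
  continuous_on_seg f P Q ->
  is_RInt (V := C_R_CompleteNormedModule) (fun t => f (seg_point P Q t)) 0 1
    (C_RInt (fun t => f (seg_point P Q t)) 0 1).
Proof.
intros Hf. apply (RInt_correct (V := C_R_CompleteNormedModule)).
apply (ex_RInt_continuous (V := C_R_CompleteNormedModule)). intros t Ht.
apply continuous_seg_point, Hf.
rewrite Rmin_left, Rmax_right in Ht by lra. exact Ht.
Qed.

Lemma seg_of_is_RInt (f : C -> C) (P Q : C) (l : C) :
  is_RInt (V := C_R_CompleteNormedModule) (fun t => f (seg_point P Q t)) 0 1 l ->
  seg f P Q = ((Q - P) * l)%C.
Proof. intros H. unfold seg. f_equal. exact (is_RInt_unique _ _ _ _ H). Qed.

Lemma seg_ext (f g : C -> C) (P Q : C) :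
  (forall t, 0 <= t <= 1 -> f (seg_point P Q t) = g (seg_point P Q t)) ->
  seg f P Q = seg g P Q.
Proof.
intros H. unfold seg. f_equal. apply (RInt_ext (V := C_R_CompleteNormedModule)). intros t Ht.
rewrite Rmin_left, Rmax_right in Ht by lra. apply H. lra.
Qed.

(** Here [C] is a real normed module, where linearity concerns real scalars; a complex factor is
    treated through real and imaginary parts. *)
Lemma is_RInt_Cmult (c : C) (f : R -> C) (a b : R) (l : C) :
  is_RInt (V := C_R_CompleteNormedModule) f a b l ->
  is_RInt (V := C_R_CompleteNormedModule) (fun t => c * f t)%C a b (c * l)%C.
Proof.
intros H.
assert (H1 := is_RInt_fct_extend_fst (U := R_NormedModule) (V := R_NormedModule) f a b l H).
assert (H2 := is_RInt_fct_extend_snd (U := R_NormedModule) (V := R_NormedModule) f a b l H).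
apply (is_RInt_fct_extend_pair (U := R_NormedModule) (V := R_NormedModule)).
- apply (is_RInt_minus (V := R_NormedModule) (fun t => fst c * fst (f t)) (fun t => snd c * snd (f t)));
    apply (is_RInt_scal (V := R_NormedModule)); assumption.
- apply (is_RInt_plus (V := R_NormedModule) (fun t => fst c * snd (f t)) (fun t => snd c * fst (f t)));
    apply (is_RInt_scal (V := R_NormedModule)); assumption.
Qed.

Lemma seg_lin (f g : C -> C) (a b P Q : C) :
  continuous_on_seg f P Q -> continuous_on_seg g P Q ->
  seg (fun z => a * f z + b * g z)%C P Q = (a * seg f P Q + b * seg g P Q)%C.
Proof.
intros Hf Hg.
rewrite (seg_of_is_RInt (fun z => a * f z + b * g z)%C P Q
  (a * C_RInt (fun t => f (seg_point P Q t)) 0 1 + b * C_RInt (fun t => g (seg_point P Q t)) 0 1)%C).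
- unfold seg. ring.
- apply (is_RInt_plus (V := C_R_CompleteNormedModule)); apply is_RInt_Cmult; now apply is_C_RInt_seg.
Qed.

Lemma seg_bound (f : C -> C) (P Q : C) (M : R) :
  continuous_on_seg f P Q ->
  (forall t, 0 <= t <= 1 -> Cmod (f (seg_point P Q t)) <= M) ->
  Cmod (seg f P Q) <= Cmod (Q - P) * M.
Proof.
intros Hf HM. unfold seg. rewrite Cmod_mult.
apply Rmult_le_compat_l; [apply Cmod_ge_0|].
assert (Hn : forall z : C, norm (K := R_AbsRing) (V := C_R_NormedModule) z = Cmod z).
{ intros z. change (sqrt (Rabs (fst z) ^ 2 + Rabs (snd z) ^ 2) = sqrt (fst z ^ 2 + snd z ^ 2)).
  now rewrite !pow2_abs. }
assert (H := norm_RInt_le_const (V := C_R_NormedModule) _ 0 1 _ M Rle_0_1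
  (fun t Ht => Rle_trans _ _ _ (Req_le _ _ (Hn _)) (HM t Ht)) (is_C_RInt_seg f P Q Hf)).
rewrite Hn in H. lra.
Qed.

Lemma seg_rev (f : C -> C) (P Q : C) :
  continuous_on_seg f P Q -> seg f Q P = (- seg f P Q)%C.
Proof.
intros Hf.
assert (H := is_C_RInt_seg f P Q Hf).
apply (is_RInt_swap (V := C_R_CompleteNormedModule)) in H.
(* The bounds are written as images of [0] and [1] under [t -> 1 - t], the substitution that
   reverses the segment. *)
replace 1 with (-1 * 0 + 1) in H at 1 by ring.
replace 0 with (-1 * 1 + 1) in H at 2 by ring.
apply (is_RInt_comp_lin (V := C_R_CompleteNormedModule)) in H.
apply (is_RInt_scal (V := C_R_CompleteNormedModule) _ _ _ (-1)) in H.
rewrite (seg_of_is_RInt f Q P (C_RInt (fun t => f (seg_point P Q t)) 0 1)).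
- unfold seg. ring.
- eapply is_RInt_ext; [|].
  2:{ match type of H with is_RInt _ _ _ ?l =>
        replace l with (C_RInt (fun t => f (seg_point P Q t)) 0 1) in H; [exact H|] end.
      rewrite scal_R_Cmult. change (C_RInt (fun t => f (seg_point P Q t)) 0 1 = (RtoC (-1) * - C_RInt (fun t => f (seg_point P Q t)) 0 1)%C). ring. }
  intros t _. simpl. rewrite !scal_R_Cmult.
  replace (seg_point P Q (-1 * t + 1)) with (seg_point Q P t); [ring|].
  unfold seg_point. rewrite RtoC_plus, RtoC_mult. ring.
Qed.

Lemma seg_mid (f : C -> C) (P Q : C) :
  continuous_on_seg f P Q ->
  seg f P Q = (seg f P ((P + Q) / 2) + seg f ((P + Q) / 2) Q)%C.
Proof.
intros Hf.
assert (Hex : ex_RInt (V := C_R_CompleteNormedModule) (fun t => f (seg_point P Q t)) 0 1)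
  by (eexists; apply is_C_RInt_seg, Hf).
assert (H1 := ex_RInt_Chasles_1 (V := C_R_CompleteNormedModule) _ 0 (1 / 2) 1 ltac:(lra) Hex).
assert (H2 := ex_RInt_Chasles_2 (V := C_R_CompleteNormedModule) _ 0 (1 / 2) 1 ltac:(lra) Hex).
destruct H1 as [l1 H1], H2 as [l2 H2].
assert (H3 := is_RInt_Chasles (V := C_R_CompleteNormedModule) _ _ _ _ _ _ H1 H2).
rewrite (seg_of_is_RInt f P Q _ H3).
(* Each half of the parameter interval is an affine image of the whole one; the factor [2] below
   compensates for the halved velocity. *)
replace 0 with (1 / 2 * 0 + 0) in H1 at 1 by field.
replace (1 / 2) with (1 / 2 * 1 + 0) in H1 at 2 by field.
replace (1 / 2) with (1 / 2 * 0 + 1 / 2) in H2 at 1 by field.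
replace 1 with (1 / 2 * 1 + 1 / 2) in H2 at 3 by field.
apply (is_RInt_comp_lin (V := C_R_CompleteNormedModule)) in H1, H2.
apply (is_RInt_scal (V := C_R_CompleteNormedModule) _ _ _ 2) in H1, H2.
rewrite (seg_of_is_RInt f P ((P + Q) / 2) (RtoC 2 * l1)%C),
  (seg_of_is_RInt f ((P + Q) / 2) Q (RtoC 2 * l2)%C).
- change (plus l1 l2) with (l1 + l2)%C. field.
- rewrite scal_R_Cmult in H2. eapply is_RInt_ext; [|exact H2].
  intros t _. simpl. rewrite !scal_R_Cmult.
  replace (seg_point P Q (1 / 2 * t + 1 / 2)) with (seg_point ((P + Q) / 2) Q t).
  + rewrite RtoC_div by lra. field.
  + unfold seg_point. rewrite RtoC_plus, RtoC_mult, RtoC_div by lra. field.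
- rewrite scal_R_Cmult in H1. eapply is_RInt_ext; [|exact H1].
  intros t _. simpl. rewrite !scal_R_Cmult.
  replace (seg_point P Q (1 / 2 * t + 0)) with (seg_point P ((P + Q) / 2) t).
  + rewrite RtoC_div by lra. field.
  + unfold seg_point. rewrite RtoC_plus, RtoC_mult, RtoC_div by lra. field.
Qed.

(** The value is a difference of the primitive [a * z + b * z ^ 2 / 2], so these integrals cancel
    around a triangle. *)
Lemma seg_affine (a b P Q : C) :
  seg (fun z => a + b * z)%C P Q = (a * (Q - P) + b * ((Q * Q - P * P) / 2))%C.
Proof.
rewrite (seg_of_is_RInt _ P Q ((a + b * P) + b * (Q - P) * RtoC (1 / 2))%C).
- rewrite RtoC_div by lra. field.
- apply (is_RInt_ext (V := C_R_CompleteNormedModule)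
    (fun t => (a + b * P) + b * (Q - P) * RtoC t)%C).
  { intros t _. unfold seg_point. simpl. ring. }
  apply (is_RInt_plus (V := C_R_CompleteNormedModule)).
  + assert (H := is_RInt_const (V := C_R_CompleteNormedModule) 0 1 (a + b * P)%C).
    rewrite scal_R_Cmult in H. replace (RtoC (1 - 0) * (a + b * P))%C with (a + b * P)%C in H; [exact H|].
    replace (1 - 0) with 1 by ring. ring.
  + apply is_RInt_Cmult.
    apply (is_RInt_fct_extend_pair (U := R_NormedModule) (V := R_NormedModule)); simpl.
    * assert (H := is_RInt_derive (V := R_CompleteNormedModule) (fun t => t ^ 2 / 2) (fun t => t) 0 1).
      replace (1 / 2) with (minus (1 ^ 2 / 2) (0 ^ 2 / 2)).
      -- apply H; intros t _; [auto_derive; [easy|field]|apply continuous_id].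
      -- unfold minus, plus, opp; simpl. field.
    * assert (H := is_RInt_const (V := R_NormedModule) 0 1 0).
      change (scal (1 - 0) 0) with ((1 - 0) * 0) in H. rewrite Rmult_0_r in H.
      apply (is_RInt_ext (fun _ => 0)); [|exact H]. intros t _. simpl. ring.
Qed.

(** * Goursat's theorem for triangles *)

Definition convex (D : C -> Prop) : Prop :=
  forall P Q t, D P -> D Q -> 0 <= t <= 1 -> D (seg_point P Q t).

Definition tri (f : C -> C) (P Q W : C) : C := (seg f P Q + seg f Q W + seg f W P)%C.

Lemma continuous_on_seg_convex (D : C -> Prop) (f : C -> C) (P Q : C) :
  convex D -> (forall z, D z -> C_derivable f z) -> D P -> D Q -> continuous_on_seg f P Q.
Proof. intros HD Hf HP HQ t Ht. apply C_derivable_continuous, Hf. now apply HD. Qed.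

Lemma seg_point_half (P Q : C) : seg_point P Q (1 / 2) = ((P + Q) / 2)%C.
Proof. unfold seg_point. rewrite RtoC_div by lra. field. Qed.

(** Each edge of the middle triangle is run through once in each direction and cancels. *)
Lemma tri_subdivide (D : C -> Prop) (f : C -> C) (P Q W : C) :
  convex D -> (forall z, D z -> C_derivable f z) -> D P -> D Q -> D W ->
  let M := ((P + Q) / 2)%C in let N := ((Q + W) / 2)%C in let K := ((W + P) / 2)%C in
  tri f P Q W = (tri f P M K + tri f M Q N + tri f K N W + tri f N K M)%C.
Proof.
intros HD Hf HP HQ HW M N K.
assert (HM : D M) by (unfold M; rewrite <- seg_point_half; apply HD; auto; lra).
assert (HN : D N) by (unfold N; rewrite <- seg_point_half; apply HD; auto; lra).
assert (HK : D K) by (unfold K; rewrite <- seg_point_half; apply HD; auto; lra).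
assert (Hc : forall A B, D A -> D B -> continuous_on_seg f A B)
  by (intros; now apply (continuous_on_seg_convex D)).
unfold tri.
rewrite (seg_mid f P Q), (seg_mid f Q W), (seg_mid f W P) by auto.
fold M N K.
rewrite (seg_rev f M K), (seg_rev f N K), (seg_rev f M N) by auto. ring.
Qed.

(** The intervals of radius [(1 / 2) ^ n] around [a n] are nested, so the supremum of their left
    ends lies in all of them. *)
Lemma geometric_limit (a : nat -> R) :
  (forall n, Rabs (a (S n) - a n) <= (1 / 2) ^ S n) ->
  exists l, forall n, Rabs (a n - l) <= (1 / 2) ^ n.
Proof.
intros Ha.
assert (Hmono : forall n k, a n - (1 / 2) ^ n <= a (n + k)%nat - (1 / 2) ^ (n + k) /\
                            a (n + k)%nat + (1 / 2) ^ (n + k) <= a n + (1 / 2) ^ n).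
{ intros n k. induction k as [|k [IH1 IH2]].
  - rewrite Nat.add_0_r. lra.
  - rewrite Nat.add_succ_r. specialize (Ha (n + k)%nat). simpl in Ha |- *.
    apply Rabs_le_between in Ha. lra. }
assert (Hle : forall n m, a n - (1 / 2) ^ n <= a m + (1 / 2) ^ m).
{ intros n m. assert (H1 := proj1 (Hmono n m)). assert (H2 := proj2 (Hmono m n)).
  rewrite (Nat.add_comm m n) in H2.
  assert (H3 : 0 < (1 / 2) ^ (n + m)) by (apply pow_lt; lra). lra. }
destruct (completeness (fun x => exists n, x = a n - (1 / 2) ^ n)) as [l [Hub Hlub]].
- exists (a 0%nat + (1 / 2) ^ 0). intros x [n ->]. apply Hle.
- now exists (a 0%nat - (1 / 2) ^ 0), 0%nat.
- exists l. intros n. apply Rabs_le_between.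
  assert (H1 := Hub _ (ex_intro _ n eq_refl)).
  assert (H2 : l <= a n + (1 / 2) ^ n) by (apply Hlub; intros x [m ->]; apply Hle).
  lra.
Qed.

Lemma pow_half_small (eps : R) : 0 < eps -> exists n, (1 / 2) ^ n < eps.
Proof.
intros He. destruct (pow_lt_1_zero (1 / 2) ltac:(rewrite Rabs_pos_eq; lra) eps He) as [n Hn].
exists n. specialize (Hn n (le_n n)). rewrite Rabs_pos_eq in Hn; [exact Hn|].
apply pow_le; lra.
Qed.

Lemma le_0_of_le_pow_half (x : R) : (forall n, x <= (1 / 2) ^ n) -> x <= 0.
Proof.
intros H. apply Rnot_lt_le. intros Hx. destruct (pow_half_small x Hx) as [n Hn].
specialize (H n). lra.
Qed.

Lemma Cmod_seg_point_le (P Q Z : C) (t r : R) :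
  0 <= t <= 1 -> Cmod (P - Z) <= r -> Cmod (Q - Z) <= r -> Cmod (seg_point P Q t - Z) <= r.
Proof.
intros Ht HP HQ.
replace (seg_point P Q t - Z)%C with (RtoC (1 - t) * (P - Z) + RtoC t * (Q - Z))%C
  by (unfold seg_point; rewrite RtoC_minus; ring).
eapply Rle_trans; [apply Cmod_triangle|].
rewrite !Cmod_mult, !Cmod_R, !Rabs_pos_eq by lra. nra.
Qed.

(** The affine part of [f] at [Z] integrates to [0]. The remainder is at most [eta * r] on three
    edges of length at most [2 * r]. *)
Lemma tri_local_bound (D : C -> Prop) (f : C -> C) (P Q W Z l : C) (eta r : R) :
  convex D -> (forall z, D z -> C_derivable f z) -> D P -> D Q -> D W ->
  0 <= eta ->
  (forall y, Cmod (y - Z) <= r -> Cmod (f y - f Z - (y - Z) * l) <= eta * Cmod (y - Z)) ->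
  Cmod (P - Z) <= r -> Cmod (Q - Z) <= r -> Cmod (W - Z) <= r ->
  Cmod (tri f P Q W) <= 6 * eta * r ^ 2.
Proof.
intros HD Hf HP HQ HW Heta Hl HPr HQr HWr.
assert (Hr : 0 <= r) by (eapply Rle_trans; [apply Cmod_ge_0|exact HPr]).
set (g := fun y => (f y - f Z - (y - Z) * l)%C).
set (h := fun y => ((f Z - Z * l) + l * y)%C).
assert (Hg : forall z, D z -> C_derivable g z)
  by (intros z Hz; specialize (Hf z Hz); unfold g; C_derive_tac).
assert (Hh : forall z, D z -> C_derivable h z) by (intros z Hz; unfold h; C_derive_tac).
assert (Hsplit : forall A B, D A -> D B ->
  seg f A B = (seg g A B + ((f Z - Z * l) * (B - A) + l * ((B * B - A * A) / 2)))%C).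
{ intros A B HA HB. rewrite <- seg_affine. fold h.
  replace (seg g A B + seg h A B)%C with (1 * seg g A B + 1 * seg h A B)%C by ring.
  rewrite <- seg_lin; try (now apply (continuous_on_seg_convex D)).
  apply seg_ext. intros t _. unfold g, h. ring. }
assert (Hb : forall A B, D A -> D B -> Cmod (A - Z) <= r -> Cmod (B - Z) <= r ->
  Cmod (seg g A B) <= 2 * eta * r ^ 2).
{ intros A B HA HB HAr HBr.
  eapply Rle_trans; [apply (seg_bound _ _ _ (eta * r))|].
  - now apply (continuous_on_seg_convex D).
  - intros t Ht.
    assert (H := Cmod_seg_point_le A B Z t r Ht HAr HBr).
    eapply Rle_trans; [apply Hl, H|]. now apply Rmult_le_compat_l.
  - assert (H := Cmod_minus_triangle B Z A). rewrite (Cmod_minus_sym Z A) in H.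
    replace (2 * eta * r ^ 2) with (2 * r * (eta * r)) by ring.
    apply Rmult_le_compat_r; [now apply Rmult_le_pos|lra]. }
unfold tri. rewrite !Hsplit by assumption.
match goal with |- Cmod ?X <= _ =>
  replace X with (seg g P Q + seg g Q W + seg g W P)%C by field end.
assert (H1 := Hb P Q HP HQ HPr HQr).
assert (H2 := Hb Q W HQ HW HQr HWr).
assert (H3 := Hb W P HW HP HWr HPr).
assert (H4 := Cmod_triangle (seg g P Q + seg g Q W) (seg g W P)).
assert (H5 := Cmod_triangle (seg g P Q) (seg g Q W)). lra.
Qed.

Section Goursat.

Variables (D : C -> Prop) (f : C -> C) (P u v : C).
Hypothesis HD : convex D.
Hypothesis Hf : forall z, D z -> C_derivable f z.
Hypothesis HP : D P.
Hypothesis Hu : D (P + u)%C.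
Hypothesis Hv : D (P + v)%C.

Let pt (s t : R) : C := (P + RtoC s * u + RtoC t * v)%C.
(** All triangles of the subdivision are homothetic to the initial one, so a corner and a ratio [d]
    describe them; a negative [d] means an inverted triangle. *)
Let cell := (R * R * R)%type.
Let in_hull (s t : R) : Prop := 0 <= s /\ 0 <= t /\ s + t <= 1.
Let cell_in (c : cell) : Prop :=
  let '(s, t, d) := c in in_hull s t /\ in_hull (s + d) t /\ in_hull s (t + d).
Let cell_tri (c : cell) : C :=
  let '(s, t, d) := c in tri f (pt s t) (pt (s + d) t) (pt s (t + d)).
(** The threshold scales like the area: four quarters that are not bad bound the whole by
    [4 * eps * (d / 2) ^ 2 = eps * d ^ 2]. *)
Let bad (eps : R) (c : cell) : Prop :=
  cell_in c /\ eps * snd c ^ 2 < Cmod (cell_tri c).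

Lemma D_pt (s t : R) : in_hull s t -> D (pt s t).
Proof.
(* Off the corner [P], the point lies on the segment from [P] to a point of the opposite side, whose
   parameter is [t / (s + t)]. *)
intros (Hs & Ht & Hst). destruct (Req_dec (s + t) 0) as [H0|H0].
- replace s with 0 by lra. replace t with 0 by lra.
  replace (pt 0 0) with P by (unfold pt; ring). exact HP.
- replace (pt s t) with (seg_point P (seg_point (P + u) (P + v) (t / (s + t))) (s + t)).
  + apply HD; [exact HP| |lra]. apply HD; [exact Hu|exact Hv|].
    split; [apply Rdiv_le_0_compat; lra|]. apply Rle_div_l; lra.
  + unfold pt, seg_point. rewrite RtoC_div, RtoC_plus by exact H0.
    assert (H1 : (RtoC s + RtoC t)%C <> 0)
      by (rewrite <- RtoC_plus; intros H; now apply RtoC_inj in H).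
    field. exact H1.
Qed.

Lemma bad_child (eps : R) (c : cell) : bad eps c ->
  exists c' : cell, bad eps c' /\ Rabs (snd c') = Rabs (snd c) / 2 /\
    Rabs (fst (fst c') - fst (fst c)) <= Rabs (snd c) / 2 /\
    Rabs (snd (fst c') - snd (fst c)) <= Rabs (snd c) / 2.
Proof.
destruct c as [[s t] d]. intros [Hin Hbig]. simpl in Hbig.
destruct Hin as (H1 & H2 & H3).
assert (Hsub := tri_subdivide D f _ _ _ HD Hf (D_pt _ _ H1) (D_pt _ _ H2) (D_pt _ _ H3)).
assert (Habs : Rabs (d / 2) = Rabs d / 2)
  by (unfold Rdiv; rewrite Rabs_mult, (Rabs_pos_eq (/ 2)); lra).
assert (Habs' : Rabs (- (d / 2)) = Rabs d / 2) by now rewrite Rabs_Ropp.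
assert (Hdiff : forall x, Rabs (x + d / 2 - x) <= Rabs d / 2)
  by (intros x; replace (x + d / 2 - x) with (d / 2) by ring; lra).
assert (Hdiff0 : forall x, Rabs (x - x) <= Rabs d / 2)
  by (intros x; rewrite Rminus_diag, Rabs_R0; assert (H := Rabs_pos d); lra).
unfold in_hull in H1, H2, H3.
destruct (Rlt_le_dec (eps * (d / 2) ^ 2) (Cmod (cell_tri (s, t, d / 2)))) as [Hc|Hc1].
{ exists (s, t, d / 2). repeat split; simpl; auto; lra. }
destruct (Rlt_le_dec (eps * (d / 2) ^ 2) (Cmod (cell_tri (s + d / 2, t, d / 2)))) as [Hc|Hc2].
{ exists (s + d / 2, t, d / 2). repeat split; simpl; auto; lra. }
destruct (Rlt_le_dec (eps * (d / 2) ^ 2) (Cmod (cell_tri (s, t + d / 2, d / 2)))) as [Hc|Hc3].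
{ exists (s, t + d / 2, d / 2). repeat split; simpl; auto; lra. }
(* The middle triangle is inverted, hence the ratio [- (d / 2)]. *)
destruct (Rlt_le_dec (eps * (- (d / 2)) ^ 2) (Cmod (cell_tri (s + d / 2, t + d / 2, - (d / 2))))) as [Hc|Hc4].
{ exists (s + d / 2, t + d / 2, - (d / 2)). repeat split; simpl; auto; lra. }
exfalso. simpl in Hsub, Hc1, Hc2, Hc3, Hc4.
assert (Hpt : forall a b a' b', ((pt a b + pt a' b') / 2)%C = pt ((a + a') / 2) ((b + b') / 2))
  by (intros; unfold pt; rewrite !RtoC_div, !RtoC_plus by lra; field).
rewrite !Hpt in Hsub.
replace ((s + (s + d)) / 2) with (s + d / 2) in Hsub by field.
replace ((s + d + s) / 2) with (s + d / 2) in Hsub by field.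
replace ((s + s) / 2) with s in Hsub by field.
replace ((t + (t + d)) / 2) with (t + d / 2) in Hsub by field.
replace ((t + d + t) / 2) with (t + d / 2) in Hsub by field.
replace ((t + t) / 2) with t in Hsub by field.
replace (s + d / 2 + d / 2) with (s + d) in Hc2 by field.
replace (t + d / 2 + d / 2) with (t + d) in Hc3 by field.
replace (s + d / 2 + - (d / 2)) with s in Hc4 by ring.
replace (t + d / 2 + - (d / 2)) with t in Hc4 by ring.
revert Hbig. apply Rle_not_lt. rewrite Hsub.
eapply Rle_trans; [apply Cmod_triangle|].
eapply Rle_trans; [apply Rplus_le_compat_r, Cmod_triangle|].
eapply Rle_trans; [apply Rplus_le_compat_r, Rplus_le_compat_r, Cmod_triangle|].
lra.
Qed.

(** Successive bad cells shrink to a point of the triangle, where differentiability makes the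
    integral over a small cell less than its threshold. *)
Lemma not_bad (eps : R) : 0 < eps -> ~ bad eps (0, 0, 1).
Proof.
intros Heps Hbad0.
(* Choosing on the subtype of bad cells gives a successor map that can be iterated. *)
destruct (functional_choice (A := {c | bad eps c}) (B := {c | bad eps c})
  (fun c c' => Rabs (snd (proj1_sig c')) = Rabs (snd (proj1_sig c)) / 2 /\
    Rabs (fst (fst (proj1_sig c')) - fst (fst (proj1_sig c))) <= Rabs (snd (proj1_sig c)) / 2 /\
    Rabs (snd (fst (proj1_sig c')) - snd (fst (proj1_sig c))) <= Rabs (snd (proj1_sig c)) / 2))
  as [next Hnext].
{ intros [c Hc]. destruct (bad_child eps c Hc) as [c' [Hc' H]].
  exists (exist _ c' Hc'). exact H. }
set (T := fun n => Nat.iter n next (exist _ (0, 0, 1) Hbad0)).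
set (s := fun n => fst (fst (proj1_sig (T n)))).
set (t := fun n => snd (fst (proj1_sig (T n)))).
set (d := fun n => snd (proj1_sig (T n))).
assert (Hd : forall n, Rabs (d n) = (1 / 2) ^ n).
{ intros n. induction n as [|n IH]; [apply Rabs_R1|].
  unfold d. simpl. rewrite (proj1 (Hnext (T n))). fold (d n). rewrite IH. simpl. field. }
destruct (geometric_limit s) as [s0 Hs].
{ intros n. eapply Rle_trans; [exact (proj1 (proj2 (Hnext (T n))))|].
  fold (d n). rewrite Hd. simpl. lra. }
destruct (geometric_limit t) as [t0 Ht].
{ intros n. eapply Rle_trans; [exact (proj2 (proj2 (Hnext (T n))))|].
  fold (d n). rewrite Hd. simpl. lra. }
assert (Hbad : forall n, bad eps (s n, t n, d n)).
{ intros n. unfold s, t, d. destruct (T n) as [[[a b] c] Hc]. exact Hc. }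
assert (Hin : in_hull s0 t0).
{ assert (Hn : forall n, in_hull (s n) (t n)) by (intros n; exact (proj1 (proj1 (Hbad n)))).
  (* The hull is closed: its inequalities pass to the limit. The third one collects two errors of
     [(1 / 2) ^ n], hence the division by [2]. *)
  assert (Hb : forall n, - s0 <= (1 / 2) ^ n /\ - t0 <= (1 / 2) ^ n /\ (s0 + t0 - 1) / 2 <= (1 / 2) ^ n).
  { intros n. destruct (Hn n) as (A1 & A2 & A3).
    assert (B1 := proj1 (Rabs_le_between _ _) (Hs n)).
    assert (B2 := proj1 (Rabs_le_between _ _) (Ht n)). lra. }
  assert (C1 : - s0 <= 0) by (apply le_0_of_le_pow_half; intros n; apply Hb).
  assert (C2 : - t0 <= 0) by (apply le_0_of_le_pow_half; intros n; apply Hb).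
  assert (C3 : (s0 + t0 - 1) / 2 <= 0) by (apply le_0_of_le_pow_half; intros n; apply Hb).
  unfold in_hull. lra. }
destruct (Hf _ (D_pt _ _ Hin)) as [l Hl].
set (L := Cmod u + Cmod v).
assert (HL : 0 <= L) by (apply Rplus_le_le_0_compat; apply Cmod_ge_0).
(* Here [24] is the [6] of [tri_local_bound] times the [4] from squaring [2 * h * L], and [+ 1]
   avoids dividing by [0]. *)
assert (Heta : 0 < eps / (24 * (L ^ 2 + 1)))
  by (apply Rdiv_lt_0_compat; [exact Heps|assert (H := pow2_ge_0 L); lra]).
destruct (proj1 (is_C_derive_iff _ _ _) Hl _ Heta) as [del [Hdel Hloc]].
destruct (pow_half_small (del / (2 * L + 1))) as [n Hn]; [apply Rdiv_lt_0_compat; lra|].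
apply Rlt_div_r in Hn; [|lra].
set (h := (1 / 2) ^ n) in *.
assert (Hh : 0 < h) by (apply pow_lt; lra).
assert (Hclose : forall a b, Rabs (a - s0) <= 2 * h -> Rabs (b - t0) <= 2 * h ->
  Cmod (pt a b - pt s0 t0) <= 2 * h * L).
{ intros a b Ha Hb.
  replace (pt a b - pt s0 t0)%C with (RtoC (a - s0) * u + RtoC (b - t0) * v)%C
    by (unfold pt; rewrite !RtoC_minus; ring).
  eapply Rle_trans; [apply Cmod_triangle|]. rewrite !Cmod_mult, !Cmod_R.
  assert (A1 := Cmod_ge_0 u). assert (A2 := Cmod_ge_0 v). unfold L. nra. }
specialize (Hs n). specialize (Ht n). specialize (Hd n). fold h in Hs, Ht, Hd.
assert (Hs' : Rabs (s n + d n - s0) <= 2 * h).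
{ replace (s n + d n - s0) with ((s n - s0) + d n) by ring.
  eapply Rle_trans; [apply Rabs_triang|]. lra. }
assert (Ht' : Rabs (t n + d n - t0) <= 2 * h).
{ replace (t n + d n - t0) with ((t n - t0) + d n) by ring.
  eapply Rle_trans; [apply Rabs_triang|]. lra. }
destruct (Hbad n) as [(H1 & H2 & H3) Hbig]. simpl in Hbig.
assert (Hbound := tri_local_bound D f (pt (s n) (t n)) (pt (s n + d n) (t n)) (pt (s n) (t n + d n))
  (pt s0 t0) l _ (2 * h * L) HD Hf (D_pt _ _ H1) (D_pt _ _ H2) (D_pt _ _ H3) (Rlt_le _ _ Heta)).
assert (Hd2 : d n * (d n * 1) = h ^ 2) by (rewrite <- Hd; rewrite pow2_abs; ring).
rewrite Hd2 in Hbig.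
apply (Rlt_irrefl (eps * h ^ 2)). eapply Rlt_le_trans; [exact Hbig|].
eapply Rle_trans; [apply Hbound|].
- intros y Hy. apply Hloc. eapply Rle_lt_trans; [exact Hy|]. nra.
- apply Hclose; lra.
- apply Hclose; lra.
- apply Hclose; lra.
- replace (6 * (eps / (24 * (L ^ 2 + 1))) * (2 * h * L) ^ 2)
    with (eps * h ^ 2 * (L ^ 2 / (L ^ 2 + 1))) by (field; assert (H := pow2_ge_0 L); lra).
  rewrite <- (Rmult_1_r (eps * h ^ 2)) at 2.
  apply Rmult_le_compat_l; [apply Rmult_le_pos; [lra|apply pow2_ge_0]|].
  apply Rle_div_l; [assert (H := pow2_ge_0 L); lra|lra].
Qed.

Lemma goursat_aux : tri f P (P + u) (P + v) = 0.
Proof.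
apply Cmod_eq_0, Rle_antisym; [|apply Cmod_ge_0].
apply le_epsilon. intros eps Heps. rewrite Rplus_0_l.
apply Rnot_lt_le. intros Hbig. apply (not_bad eps Heps). split.
- unfold cell_in, in_hull. lra.
- simpl. rewrite !Rplus_0_l, !Rmult_1_r.
  replace (pt 0 0) with P by (unfold pt; ring).
  replace (pt 1 0) with (P + u)%C by (unfold pt; ring).
  replace (pt 0 1) with (P + v)%C by (unfold pt; ring). exact Hbig.
Qed.

End Goursat.

Lemma goursat (D : C -> Prop) (f : C -> C) (P Q W : C) :
  convex D -> (forall z, D z -> C_derivable f z) -> D P -> D Q -> D W -> tri f P Q W = 0.
Proof.
intros HD Hf HP HQ HW.
replace Q with (P + (Q - P))%C by ring. replace W with (P + (W - P))%C by ring.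
apply (goursat_aux D); try assumption.
- now replace (P + (Q - P))%C with Q by ring.
- now replace (P + (W - P))%C with W by ring.
Qed.

(** * Integrals along diamonds and Cauchy's formula *)

Definition diamond_int (f : C -> C) (w : C) (r : R) : C :=
  (seg f (w + RtoC r) (w + RtoC r * Ci) + seg f (w + RtoC r * Ci) (w - RtoC r)
   + seg f (w - RtoC r) (w - RtoC r * Ci) + seg f (w - RtoC r * Ci) (w + RtoC r))%C.

(** The diamond lies between the circles of radii [r / sqrt 2] and [r]; [r / 2] is a simpler lower
    bound. *)
Definition annulus (w : C) (r : R) (z : C) : Prop := r / 2 <= Cmod (z - w) <= r.

Lemma Cmod_le_sum (z : C) : Cmod z <= Rabs (fst z) + Rabs (snd z).
Proof.
unfold Cmod. apply Rsqr_incr_0_var; [|assert (A := Rabs_pos (fst z)); assert (B := Rabs_pos (snd z)); lra].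
rewrite Rsqr_sqrt by nra. rewrite <- (pow2_abs (fst z)), <- (pow2_abs (snd z)). unfold Rsqr.
assert (A := Rabs_pos (fst z)); assert (B := Rabs_pos (snd z)). nra.
Qed.

Lemma Cmod_coords (z : C) : Rabs (fst z) <= Cmod z /\ Rabs (snd z) <= Cmod z.
Proof.
assert (H := Rmax_Cmod z). split; (eapply Rle_trans; [|exact H]); [apply Rmax_l|apply Rmax_r].
Qed.

(** Where the absolute coordinates add up to [1], the larger is at least [1 / 2], and the modulus
    lies between it and their sum. *)
Lemma edge_annulus (w a b : C) (r t : R) :
  0 < r -> 0 <= t <= 1 ->
  Rabs ((1 - t) * fst a + t * fst b) + Rabs ((1 - t) * snd a + t * snd b) = 1 ->
  annulus w r (seg_point (w + RtoC r * a) (w + RtoC r * b) t).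
Proof.
intros Hr Ht Hab. unfold annulus.
replace (seg_point (w + RtoC r * a) (w + RtoC r * b) t - w)%C
  with (RtoC r * (((1 - t) * fst a + t * fst b)%R, ((1 - t) * snd a + t * snd b)%R))%C.
2:{ unfold seg_point. apply injective_projections; simpl; ring. }
rewrite Cmod_mult, Cmod_R, Rabs_pos_eq by lra.
match goal with |- _ <= r * Cmod ?p <= _ =>
  assert (H1 := Cmod_le_sum p); assert (H2 := Cmod_coords p) end.
simpl in H1, H2. nra.
Qed.

(** Reduces a property of the four edges to one check on a generic segment of the annulus. *)
Lemma diamond_edges (P : C -> C -> Prop) (w : C) (r : R) :
  0 < r ->
  (forall A B, Cmod (B - A) <= 2 * r ->
     (forall t, 0 <= t <= 1 -> annulus w r (seg_point A B t)) -> P A B) ->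
  P (w + RtoC r)%C (w + RtoC r * Ci)%C /\ P (w + RtoC r * Ci)%C (w - RtoC r)%C /\
  P (w - RtoC r)%C (w - RtoC r * Ci)%C /\ P (w - RtoC r * Ci)%C (w + RtoC r)%C.
Proof.
intros Hr H.
assert (Hedge : forall a b A B, A = (w + RtoC r * a)%C -> B = (w + RtoC r * b)%C ->
  (forall t, 0 <= t <= 1 ->
    Rabs ((1 - t) * fst a + t * fst b) + Rabs ((1 - t) * snd a + t * snd b) = 1) -> P A B).
{ intros a b A B -> -> Hab. apply H.
  - assert (H0 := edge_annulus w a b r 0 Hr ltac:(lra) (Hab 0 ltac:(lra))).
    assert (H1 := edge_annulus w a b r 1 Hr ltac:(lra) (Hab 1 ltac:(lra))).
    unfold annulus, seg_point in H0, H1.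
    replace (w + RtoC r * b - (w + RtoC r * a))%C
      with ((w + RtoC r * a + RtoC 1 * (w + RtoC r * b - (w + RtoC r * a)) - w)
            - (w + RtoC r * a + RtoC 0 * (w + RtoC r * b - (w + RtoC r * a)) - w))%C by ring.
    eapply Rle_trans; [apply Cmod_triangle_minus|]. lra.
  - intros t Ht. now apply edge_annulus, Hab. }
assert (Hpos : forall t, 0 <= t <= 1 -> Rabs (1 - t) = 1 - t /\ Rabs t = t)
  by (intros t Ht; split; apply Rabs_pos_eq; lra).
repeat split;
  [ apply (Hedge (RtoC 1) Ci) | apply (Hedge Ci (- (1))%C)
  | apply (Hedge (- (1))%C (- Ci)%C) | apply (Hedge (- Ci)%C (RtoC 1)) ];
  try (apply injective_projections; simpl; ring);
  intros t Ht; destruct (Hpos t Ht) as [H1 H2]; simpl.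
all: unfold Rabs; repeat destruct Rcase_abs; lra.
Qed.

Lemma diamond_bound (f : C -> C) (w : C) (r M : R) :
  0 < r ->
  (forall z, annulus w r z -> C_derivable f z) ->
  (forall z, annulus w r z -> Cmod (f z) <= M) ->
  Cmod (diamond_int f w r) <= 8 * r * M.
Proof.
intros Hr Hf HM.
destruct (diamond_edges (fun A B => Cmod (seg f A B) <= 2 * r * M) w r Hr) as (H1 & H2 & H3 & H4).
{ intros A B HAB Hseg.
  assert (HM0 : 0 <= M).
  { eapply Rle_trans; [apply Cmod_ge_0|]. apply (HM _ (Hseg 0 ltac:(lra))). }
  eapply Rle_trans; [apply (seg_bound _ _ _ M)|].
  - intros t Ht. now apply C_derivable_continuous, Hf, Hseg.
  - intros t Ht. now apply HM, Hseg.
  - now apply Rmult_le_compat_r. }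
unfold diamond_int.
eapply Rle_trans; [apply Cmod_triangle|].
eapply Rle_trans; [apply Rplus_le_compat_r, Cmod_triangle|].
eapply Rle_trans; [apply Rplus_le_compat_r, Rplus_le_compat_r, Cmod_triangle|].
lra.
Qed.

Lemma diamond_ext (f g : C -> C) (w : C) (r : R) :
  0 < r -> (forall z, annulus w r z -> f z = g z) -> diamond_int f w r = diamond_int g w r.
Proof.
intros Hr H.
destruct (diamond_edges (fun A B => seg f A B = seg g A B) w r Hr) as (H1 & H2 & H3 & H4).
{ intros A B _ Hseg. apply seg_ext. intros t Ht. now apply H, Hseg. }
unfold diamond_int. congruence.
Qed.

Lemma diamond_lin (f g : C -> C) (a b w : C) (r : R) :
  0 < r ->
  (forall z, annulus w r z -> C_derivable f z) ->
  (forall z, annulus w r z -> C_derivable g z) ->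
  diamond_int (fun z => a * f z + b * g z)%C w r =
  (a * diamond_int f w r + b * diamond_int g w r)%C.
Proof.
intros Hr Hf Hg.
destruct (diamond_edges (fun A B => seg (fun z => a * f z + b * g z)%C A B =
  (a * seg f A B + b * seg g A B)%C) w r Hr) as (H1 & H2 & H3 & H4).
{ intros A B _ Hseg. apply seg_lin; intros t Ht; apply C_derivable_continuous; auto. }
unfold diamond_int. rewrite H1, H2, H3, H4. ring.
Qed.

(** The diagonal from [P] to [S] cuts the quadrilateral into two triangles. *)
Lemma goursat_quad (D : C -> Prop) (f : C -> C) (P Q S T : C) :
  convex D -> (forall z, D z -> C_derivable f z) -> D P -> D Q -> D S -> D T ->
  (seg f P Q + seg f Q S + seg f S T + seg f T P)%C = 0.
Proof.
intros HD Hf HP HQ HS HT.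
assert (H1 := goursat D f P Q S HD Hf HP HQ HS).
assert (H2 := goursat D f P S T HD Hf HP HS HT).
unfold tri in H1, H2.
rewrite (seg_rev f P S) in H1 by now apply (continuous_on_seg_convex D).
replace (seg f P Q + seg f Q S + seg f S T + seg f T P)%C with
  ((seg f P Q + seg f Q S + - seg f P S) + (seg f P S + seg f S T + seg f T P))%C by ring.
rewrite H1, H2. ring.
Qed.

Lemma diamond_goursat (D : C -> Prop) (f : C -> C) (w : C) (r : R) :
  convex D -> (forall z, D z -> C_derivable f z) ->
  D (w + RtoC r)%C -> D (w + RtoC r * Ci)%C -> D (w - RtoC r)%C -> D (w - RtoC r * Ci)%C ->
  diamond_int f w r = 0.
Proof. intros. unfold diamond_int. now apply (goursat_quad D). Qed.

(** The open half-plane with [w] on its boundary and inner normal [a]: a convex domain on which a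
    function singular only at [w] is holomorphic. *)
Definition half_plane (w a z : C) : Prop :=
  0 < fst a * (fst z - fst w) + snd a * (snd z - snd w).

Lemma half_plane_convex (w a : C) : convex (half_plane w a).
Proof.
intros P Q t HP HQ Ht. unfold half_plane in *. unfold seg_point; simpl.
replace (fst a * (fst P + (t * (fst Q + - fst P) - 0 * (snd Q + - snd P)) - fst w) +
   snd a * (snd P + (t * (snd Q + - snd P) + 0 * (fst Q + - fst P)) - snd w))
  with ((1 - t) * (fst a * (fst P - fst w) + snd a * (snd P - snd w)) +
        t * (fst a * (fst Q - fst w) + snd a * (snd Q - snd w))) by ring.
destruct (Req_dec t 0) as [->|H0]; [lra|].
apply Rplus_le_lt_0_compat; [apply Rmult_le_pos|apply Rmult_lt_0_compat]; lra.
Qed.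

(* The region between the two diamonds is cut into four quadrilaterals, each
   of which lies in a half-plane avoiding [w]. *)
Lemma diamond_deform (f : C -> C) (w0 w : C) (r0 r : R) :
  0 < r -> Cmod (w - w0) < r0 / 2 -> (forall z, z <> w -> C_derivable f z) ->
  diamond_int f w0 r0 = diamond_int f w r.
Proof.
intros Hr Hw Hf.
assert (H1 : Rabs (fst w - fst w0) < r0 / 2)
  by (eapply Rle_lt_trans; [apply (proj1 (Cmod_coords (w - w0)%C))|exact Hw]).
assert (H2 : Rabs (snd w - snd w0) < r0 / 2)
  by (eapply Rle_lt_trans; [apply (proj2 (Cmod_coords (w - w0)%C))|exact Hw]).
apply Rabs_lt_between in H1, H2.
assert (Hhp : forall a z, half_plane w a z -> C_derivable f z).
{ intros a z Hz. apply Hf. intros ->. unfold half_plane in Hz. lra. }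
assert (Hq : forall a A B b c, half_plane w a A -> half_plane w a B -> half_plane w a b ->
  half_plane w a c ->
  (seg f A B + seg f B b - seg f c b - seg f A c)%C = 0 ).
{ intros a A B b c HA HB Hb Hc.
  assert (H := goursat_quad (half_plane w a) f A B b c (half_plane_convex w a) (Hhp a) HA HB Hb Hc).
  assert (Hcont : forall X Y, half_plane w a X -> half_plane w a Y -> continuous_on_seg f X Y)
    by (intros X Y HX HY; now apply (continuous_on_seg_convex (half_plane w a) f X Y
          (half_plane_convex w a) (Hhp a))).
  rewrite (seg_rev f c b), (seg_rev f A c) in H by auto.
  rewrite <- H. ring. }
(* There is one normal per quadrant. Since both coordinates of [w - w0] are below [r0 / 2] in
   absolute value, the outer vertices lie in these half-planes; the connecting segments cancel in
   the sum. *)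
assert (Q1 := Hq (1, 1) (w0 + RtoC r0)%C (w0 + RtoC r0 * Ci)%C (w + RtoC r * Ci)%C (w + RtoC r)%C).
assert (Q2 := Hq (-1, 1) (w0 + RtoC r0 * Ci)%C (w0 - RtoC r0)%C (w - RtoC r)%C (w + RtoC r * Ci)%C).
assert (Q3 := Hq (-1, -1) (w0 - RtoC r0)%C (w0 - RtoC r0 * Ci)%C (w - RtoC r * Ci)%C (w - RtoC r)%C).
assert (Q4 := Hq (1, -1) (w0 - RtoC r0 * Ci)%C (w0 + RtoC r0)%C (w + RtoC r)%C (w - RtoC r * Ci)%C).
unfold half_plane in Q1, Q2, Q3, Q4. simpl in Q1, Q2, Q3, Q4.
specialize (Q1 ltac:(lra) ltac:(lra) ltac:(lra) ltac:(lra)).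
specialize (Q2 ltac:(lra) ltac:(lra) ltac:(lra) ltac:(lra)).
specialize (Q3 ltac:(lra) ltac:(lra) ltac:(lra) ltac:(lra)).
specialize (Q4 ltac:(lra) ltac:(lra) ltac:(lra) ltac:(lra)).
apply Ceq_minus. unfold diamond_int.
match goal with |- ?X = _ => match type of Q1 with ?A = _ => match type of Q2 with ?B = _ =>
  match type of Q3 with ?E = _ => match type of Q4 with ?F = _ =>
  replace X with (A + B + E + F)%C by ring end end end end end.
rewrite Q1, Q2, Q3, Q4. ring.
Qed.

(** The contour can be shrunk around [w], where [f] is bounded, so that the integral is as small as
    desired. *)
Lemma diamond_removable (f : C -> C) (w0 w : C) (r0 d M : R) :
  Cmod (w - w0) < r0 / 2 -> (forall z, z <> w -> C_derivable f z) ->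
  0 < d -> (forall z, z <> w -> Cmod (z - w) < d -> Cmod (f z) <= M) ->
  diamond_int f w0 r0 = 0.
Proof.
intros Hw Hf Hd HM.
assert (Hann : forall r z, 0 < r -> annulus w r z -> z <> w).
{ intros r z Hr [Hz _] ->. replace (w - w)%C with (RtoC 0) in Hz by ring. rewrite Cmod_0 in Hz. lra. }
apply Cmod_eq_0, Rle_antisym; [|apply Cmod_ge_0].
apply le_epsilon. intros eps Heps. rewrite Rplus_0_l.
set (M' := Rmax M 1). assert (HM' : 0 < M') by (assert (H := Rmax_r M 1); fold M' in H; lra).
(* The first bound keeps the small diamond where [M] bounds [f]; the second makes [8 * r * M'] at
   most [eps]. *)
set (r := Rmin (d / 2) (eps / (8 * M'))).
assert (Hr : 0 < r) by (apply Rmin_glb_lt; [lra|apply Rdiv_lt_0_compat; lra]).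
rewrite (diamond_deform f w0 w r0 r Hr Hw Hf).
eapply Rle_trans; [apply (diamond_bound f w r M' Hr)|].
- intros z Hz. apply Hf. now apply (Hann r).
- intros z Hz. eapply Rle_trans; [|apply Rmax_l]. apply HM; [now apply (Hann r)|].
  destruct Hz as [_ Hz]. assert (H := Rmin_l (d / 2) (eps / (8 * M'))). fold r in H. lra.
- assert (H := Rmin_r (d / 2) (eps / (8 * M'))). fold r in H.
  apply Rle_div_r in H; [|lra]. lra.
Qed.

(* Its value is [2 * PI * Ci]; only a lower bound for its imaginary part is needed. *)
Definition winding_const : C := (4 * seg Cinv 1 Ci)%C.

Lemma seg_inv_nz (t : R) : 0 <= t <= 1 -> seg_point 1 Ci t <> 0.
Proof.
intros Ht H. assert (H1 := f_equal fst H). assert (H2 := f_equal snd H). simpl in H1, H2. lra.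
Qed.

Lemma continuous_inv_seg : continuous_on_seg Cinv 1 Ci.
Proof.
intros t Ht. apply C_derivable_continuous. eexists. now apply is_C_derive_inv, seg_inv_nz.
Qed.

(** The form [dz / (z - w)] is invariant under dilations and rotations about [w], so all four edges
    contribute as much as the segment from [1] to [Ci]. *)
Lemma diamond_inv (w : C) (r : R) : 0 < r -> diamond_int (fun z => / (z - w))%C w r = winding_const.
Proof.
intros Hr.
assert (He : forall a A B : C, a <> 0 -> A = (w + RtoC r * a)%C -> B = (w + RtoC r * (a * Ci))%C ->
  seg (fun z => / (z - w))%C A B = seg Cinv 1 Ci).
{ intros a A B Ha -> ->.
  assert (Hr0 : RtoC r <> 0) by (intros H; apply RtoC_inj in H; lra).
  rewrite (seg_of_is_RInt _ _ _ (/ (RtoC r * a) * C_RInt (fun t => / seg_point 1 Ci t) 0 1)%C).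
  - unfold seg. field. auto.
  - eapply (is_RInt_ext (V := C_R_CompleteNormedModule));
      [|apply is_RInt_Cmult, (is_C_RInt_seg Cinv), continuous_inv_seg].
    intros t Ht. rewrite Rmin_left, Rmax_right in Ht by lra.
    assert (Ht0 := seg_inv_nz t ltac:(lra)).
    replace (seg_point (w + RtoC r * a) (w + RtoC r * (a * Ci)) t - w)%C
      with (RtoC r * a * seg_point 1 Ci t)%C by (unfold seg_point; ring).
    simpl. field. auto. }
unfold diamond_int, winding_const.
rewrite (He 1), (He Ci), (He (-(1))%C), (He (- Ci)%C);
  try (apply injective_projections; simpl; ring).
- intros H. apply (f_equal snd) in H. simpl in H. lra.
- intros H. apply (f_equal fst) in H. simpl in H. lra.
- intros H. apply (f_equal snd) in H. simpl in H. lra.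
- intros H. apply (f_equal fst) in H. simpl in H. lra.
Qed.

(** The integrand of [seg Cinv 1 Ci] has imaginary part [/ ((1 - t) ^ 2 + t ^ 2)], which is at least
    [1]. *)
Lemma winding_const_bound : 4 <= Cmod winding_const.
Proof.
assert (H : is_RInt (V := C_R_CompleteNormedModule)
  (fun t => (Ci - 1) * / seg_point 1 Ci t)%C 0 1 (seg Cinv 1 Ci)).
{ apply is_RInt_Cmult, (is_C_RInt_seg Cinv), continuous_inv_seg. }
apply (is_RInt_fct_extend_snd (U := R_NormedModule) (V := R_NormedModule)) in H.
assert (H1 : 1 <= snd (seg Cinv 1 Ci)).
{ replace 1 with (scal (1 - 0) 1) at 1 by (unfold scal; simpl; unfold mult; simpl; ring).
  refine (is_RInt_le (fun _ => 1) _ 0 1 _ _ Rle_0_1 (is_RInt_const 0 1 1) H _).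
  intros t Ht.
  assert (Hn : 0 < (1 - t) ^ 2 + t ^ 2) by nra.
  change (1 <= snd ((Ci - 1) * / seg_point 1 Ci t)%C).
  replace (snd ((Ci - 1) * / seg_point 1 Ci t)%C) with (/ ((1 - t) ^ 2 + t ^ 2)).
  - rewrite <- Rinv_1 at 1. apply Rinv_le_contravar; [exact Hn|]. nra.
  - unfold seg_point; simpl. field. nra. }
unfold winding_const. rewrite Cmod_mult, Cmod_R, Rabs_pos_eq by lra.
assert (H2 := proj2 (Cmod_coords (seg Cinv 1 Ci))).
assert (H3 := Rle_abs (snd (seg Cinv 1 Ci))). lra.
Qed.

Lemma C_derivable_cauchy_kernel (w z : C) : z <> w -> C_derivable (fun t => / (t - w))%C z.
Proof.
intros H. apply C_derivable_inv; [now apply Cminus_eq_contra|]. C_derive_tac.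
Qed.

(** The difference quotient of [f] at [w] is bounded near [w] and integrates to [0]; what remains is
    [f w] times the integral of the kernel. *)
Lemma cauchy_formula (f : C -> C) (w : C) (r : R) :
  entire f -> Cmod w < r / 2 ->
  diamond_int (fun z => f z / (z - w))%C 0 r = (winding_const * f w)%C.
Proof.
intros Hf Hw.
assert (Hr : 0 < r) by (assert (H := Cmod_ge_0 w); lra).
assert (Hw' : Cmod (w - 0) < r / 2) by (replace (w - 0)%C with w by ring; exact Hw).
assert (Hann : forall z, annulus 0 r z -> z <> w).
{ intros z [Hz _] ->. lra. }
set (q := fun z => ((f z - f w) * / (z - w))%C).
assert (Hq : forall z, z <> w -> C_derivable q z).
{ intros z Hz. apply C_derivable_mult; [|now apply C_derivable_cauchy_kernel].
  apply C_derivable_minus; [apply Hf|apply C_derivable_const]. }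
destruct (Hf w) as [l Hl].
destruct (is_C_derive_lipschitz f w l Hl) as [d [Hd Hlip]].
assert (Hq0 : diamond_int q 0 r = 0).
{ apply (diamond_removable q 0 w r d (1 + Cmod l) Hw' Hq Hd).
  intros z Hz Hzd. unfold q.
  assert (Hz0 : (z - w)%C <> 0) by now apply Cminus_eq_contra.
  rewrite Cmod_mult, Cmod_inv by exact Hz0.
  apply Cmod_gt_0 in Hz0. apply Rle_div_l; [exact Hz0|]. now apply Hlip. }
transitivity (1 * diamond_int q 0 r + f w * diamond_int (fun z => / (z - w))%C 0 r)%C.
- rewrite <- diamond_lin; [|exact Hr| |].
  + apply diamond_ext; [exact Hr|]. intros z Hz. unfold q.
    assert (Hz0 : (z - w)%C <> 0) by now apply Cminus_eq_contra, Hann.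
    field. exact Hz0.
  + intros z Hz. now apply Hq, Hann.
  + intros z Hz. now apply C_derivable_cauchy_kernel, Hann.
- rewrite Hq0, (diamond_deform _ 0 w r 1 Rlt_0_1 Hw'), diamond_inv; [ring|lra|].
  intros z Hz. now apply C_derivable_cauchy_kernel.
Qed.

(** * Injective entire functions are affine *)

Lemma annulus_0 (r : R) (z : C) : annulus 0 r z -> r / 2 <= Cmod z <= r.
Proof. unfold annulus. now replace (z - 0)%C with z by ring. Qed.

(** In Cauchy's formula, [/ (z - w)] is expanded as [1 / z + w / z ^ 2 + w ^ 2 / z ^ 3] plus the
    remainder [w ^ 3 / (z ^ 3 * (z - w))], whose integral decays like [1 / r] under quadratic
    growth. *)
Lemma cauchy_expansion (k : C -> C) (K : R) (w : C) (r : R) :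
  entire k -> (forall z, 1 <= Cmod z -> Cmod (k z) <= K * Cmod z ^ 2) ->
  2 <= r -> 4 * Cmod w <= r ->
  Cmod (winding_const * k w
        - (diamond_int (fun z => k z / z)%C 0 r
           + w * diamond_int (fun z => k z / (z * z))%C 0 r
           + w * w * diamond_int (fun z => k z / (z * z * z))%C 0 r))
    <= 64 * K * Cmod w ^ 3 / r.
Proof.
intros Hk HK Hr Hw.
assert (Hr0 : 0 < r) by lra.
assert (Hw0 := Cmod_ge_0 w).
assert (Hz0 : forall z, annulus 0 r z -> z <> 0).
{ intros z Hz. apply annulus_0 in Hz. apply Cmod_gt_0. lra. }
assert (Hzw : forall z, annulus 0 r z -> (z - w)%C <> 0).
{ intros z Hz. apply annulus_0 in Hz. apply Cmod_gt_0.
  assert (H := Cmod_triangle_rev z w). lra. }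
set (f1 := fun z => (k z / z)%C).
set (f2 := fun z => (k z / (z * z))%C).
set (f3 := fun z => (k z / (z * z * z))%C).
set (f4 := fun z => (w * w * w * k z / (z * z * z * (z - w)))%C).
assert (D1 : forall z, annulus 0 r z -> C_derivable f1 z).
{ intros z Hz. specialize (Hk z). specialize (Hz0 z Hz). unfold f1. C_derive_tac. }
assert (D2 : forall z, annulus 0 r z -> C_derivable f2 z).
{ intros z Hz. specialize (Hk z). specialize (Hz0 z Hz). unfold f2. C_derive_tac.
  repeat apply Cmult_neq_0; auto. }
assert (D3 : forall z, annulus 0 r z -> C_derivable f3 z).
{ intros z Hz. specialize (Hk z). specialize (Hz0 z Hz). unfold f3. C_derive_tac.
  repeat apply Cmult_neq_0; auto. }
assert (D4 : forall z, annulus 0 r z -> C_derivable f4 z).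
{ intros z Hz. specialize (Hk z). specialize (Hz0 z Hz). specialize (Hzw z Hz).
  unfold f4. C_derive_tac. repeat apply Cmult_neq_0; auto. }
rewrite <- (cauchy_formula k w r Hk) by lra.
rewrite (diamond_ext (fun z => k z / (z - w))%C
  (fun z => 1 * (1 * f1 z + w * f2 z) + 1 * (w * w * f3 z + 1 * f4 z))%C 0 r Hr0).
2:{ intros z Hz. specialize (Hz0 z Hz). specialize (Hzw z Hz).
    unfold f1, f2, f3, f4. field. auto. }
rewrite (diamond_lin (fun z => 1 * f1 z + w * f2 z)%C (fun z => w * w * f3 z + 1 * f4 z)%C 1 1 0 r Hr0).
2,3: intros z Hz; specialize (D1 z Hz); specialize (D2 z Hz); specialize (D3 z Hz);
     specialize (D4 z Hz); C_derive_tac.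
rewrite (diamond_lin f1 f2), (diamond_lin f3 f4) by assumption.
fold f1 f2 f3.
match goal with |- Cmod ?X <= _ => replace X with (diamond_int f4 0 r) by ring end.
(* On the diamond [Cmod z >= r / 2] and [Cmod (z - w) >= r / 4]; the factor [8 * r] comes from
   [diamond_bound]. *)
replace (64 * K * Cmod w ^ 3 / r) with (8 * r * (K * Cmod w ^ 3 / (r / 2 * (r / 4)))) by (field; lra).
apply diamond_bound; [exact Hr0|exact D4|].
intros z Hz. unfold f4.
assert (Hz1 := annulus_0 r z Hz).
assert (H := Cmod_triangle_rev z w).
rewrite Cmod_div by (repeat apply Cmult_neq_0; auto).
rewrite !Cmod_mult.
assert (HKz := HK z ltac:(lra)).
assert (HK0 : 0 <= K).
{ assert (H0 := Cmod_ge_0 (k z)). apply Rnot_lt_le. intros HKneg.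
  assert (H1 : 0 < Cmod z ^ 2) by (apply pow_lt; lra). nra. }
apply Rle_trans with (Cmod w * Cmod w * Cmod w * (K * Cmod z ^ 2) / (Cmod z * Cmod z * Cmod z * Cmod (z - w))).
{ apply Rmult_le_compat_r.
  - apply Rlt_le, Rinv_0_lt_compat. repeat apply Rmult_lt_0_compat; lra.
  - apply Rmult_le_compat_l; [|exact HKz]. repeat apply Rmult_le_pos; lra. }
replace (Cmod w * Cmod w * Cmod w * (K * Cmod z ^ 2) / (Cmod z * Cmod z * Cmod z * Cmod (z - w)))
  with (K * Cmod w ^ 3 / (Cmod z * Cmod (z - w))) by (field; lra).
apply Rmult_le_compat_l.
- apply Rmult_le_pos; [exact HK0|now apply pow_le].
- apply Rinv_le_contravar; [apply Rmult_lt_0_compat; lra|]. apply Rmult_le_compat; lra.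
Qed.

Lemma eq_0_of_decay (x K r0 : R) : 0 <= x -> (forall r, r0 <= r -> 0 < r -> x <= K / r) -> x = 0.
Proof.
intros Hx H. apply Rle_antisym; [|exact Hx]. apply Rnot_lt_le. intros Hpos.
set (r := Rmax r0 (Rmax 1 (2 * K / x))).
assert (H1 : r0 <= r) by apply Rmax_l.
assert (H2 : 1 <= r) by (eapply Rle_trans; [apply Rmax_l|apply Rmax_r]).
assert (H3 : 2 * K / x <= r) by (eapply Rle_trans; [apply Rmax_r|apply Rmax_r]).
specialize (H r H1 ltac:(lra)).
apply Rle_div_l in H3; [|exact Hpos]. apply Rle_div_r in H; [|lra]. nra.
Qed.

(** The coefficients in [cauchy_expansion] may vary with [r], so they are eliminated: [k] is
    compared with its Lagrange interpolant at [0], [1] and [- 1], and only remainders that vanish as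
    [r] grows are left. *)
Lemma liouville_quadratic (k : C -> C) (K : R) :
  entire k -> k 0 = 0 -> (forall z, 1 <= Cmod z -> Cmod (k z) <= K * Cmod z ^ 2) ->
  exists a b : C, forall z, k z = (a * (z * z) + b * z)%C.
Proof.
intros Hk Hk0 HK.
exists ((k 1 + k (- (1))%C) / 2)%C, ((k 1 - k (- (1))%C) / 2)%C. intros w.
set (X := (winding_const * (k w - ((k 1 + k (- (1))) / 2 * (w * w) + (k 1 - k (- (1))) / 2 * w)))%C).
assert (HX : Cmod X = 0).
(* The Lagrange basis for the nodes [1], [- 1] and [0], evaluated at [w]. *)
{ set (L1 := ((w * w + w) / 2)%C). set (L2 := ((w * w - w) / 2)%C). set (L0 := (1 - w * w)%C).
  apply (eq_0_of_decay _ (64 * K * (Cmod w ^ 3 + Cmod L1 + Cmod L2)) (Rmax 4 (4 * Cmod w))); [apply Cmod_ge_0|].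
  intros r Hr Hr0.
  assert (Hr4 := Rle_trans _ _ _ (Rmax_l _ _) Hr).
  assert (Hrw := Rle_trans _ _ _ (Rmax_r _ _) Hr).
  assert (Hm1 : Cmod (- (1))%C = 1) by now rewrite Cmod_opp, Cmod_1.
  assert (Ew := cauchy_expansion k K w r Hk HK ltac:(lra) Hrw).
  assert (E1 := cauchy_expansion k K 1 r Hk HK ltac:(lra) ltac:(rewrite Cmod_1; lra)).
  assert (E2 := cauchy_expansion k K (- (1))%C r Hk HK ltac:(lra) ltac:(rewrite Hm1; lra)).
  assert (E0 := cauchy_expansion k K 0 r Hk HK ltac:(lra) ltac:(rewrite Cmod_0; lra)).
  set (A := diamond_int (fun z => k z / z)%C 0 r) in *.
  set (B := diamond_int (fun z => k z / (z * z))%C 0 r) in *.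
  set (G := diamond_int (fun z => k z / (z * z * z))%C 0 r) in *.
  rewrite Cmod_1 in E1. rewrite Hm1 in E2. rewrite Cmod_0, Hk0 in E0.
  match type of Ew with Cmod ?x <= _ => set (ew := x) in * end.
  match type of E1 with Cmod ?x <= _ => set (e1 := x) in * end.
  match type of E2 with Cmod ?x <= _ => set (e2 := x) in * end.
  match type of E0 with Cmod ?x <= _ => set (e0 := x) in * end.
  replace X with (ew - L1 * e1 - L2 * e2 - L0 * e0)%C
    by (unfold X, ew, e1, e2, e0, L1, L2, L0; field).
  assert (Hpos : 0 <= Cmod e0) by apply Cmod_ge_0.
  assert (He0 : Cmod e0 = 0).
  { replace (64 * K * 0 ^ 3 / r) with 0 in E0 by (field; lra). lra. }
  replace (64 * K * (Cmod w ^ 3 + Cmod L1 + Cmod L2) / r) with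
    (64 * K * Cmod w ^ 3 / r + Cmod L1 * (64 * K * 1 ^ 3 / r) + Cmod L2 * (64 * K * 1 ^ 3 / r)
      + Cmod L0 * 0) by (field; lra).
  assert (P1 := Rmult_le_compat_l _ _ _ (Cmod_ge_0 L1) E1).
  assert (P2 := Rmult_le_compat_l _ _ _ (Cmod_ge_0 L2) E2).
  assert (P0 := Rmult_le_compat_l _ _ _ (Cmod_ge_0 L0) (Req_le _ _ He0)).
  rewrite <- Cmod_mult in P1, P2, P0.
  assert (T1 := Cmod_triangle_minus (ew - L1 * e1 - L2 * e2) (L0 * e0)).
  assert (T2 := Cmod_triangle_minus (ew - L1 * e1) (L2 * e2)).
  assert (T3 := Cmod_triangle_minus ew (L1 * e1)). lra. }
assert (Hc := winding_const_bound).
unfold X in HX. rewrite Cmod_mult in HX. apply Rmult_integral in HX.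
apply Cmod_minus_0. destruct HX as [HX|HX]; [lra|exact HX].
Qed.

Section Normalized.

Variables (psi : C -> C) (a : C).
Hypothesis Hpsi : entire psi.
Hypothesis Hinj : forall x y, psi x = psi y -> x = y.
Hypothesis H0 : psi 0 = 0.
Hypothesis Ha : a <> 0.
Hypothesis Hder : is_C_derive psi (RtoC 0) a.

Lemma psi_nz (z : C) : z <> 0 -> psi z <> 0.
Proof. intros Hz H. apply Hz, Hinj. congruence. Qed.

Lemma psi_tangent (eps : R) : 0 < eps -> exists d, 0 < d /\
  forall z, Cmod z < d -> Cmod (psi z - a * z) <= eps * Cmod z.
Proof.
intros Heps. destruct (proj1 (is_C_derive_iff _ _ _) Hder eps Heps) as [d [Hd H]].
exists d; split; [exact Hd|]. intros z Hz. specialize (H z).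
replace (z - 0)%C with z in H by ring. rewrite H0 in H.
replace (psi z - 0 - z * a)%C with (psi z - a * z)%C in H by ring. auto.
Qed.

(* If [psi] came close to [0] outside the unit disc, at a value [w] say, then
   [/ (psi - w)] would be holomorphic near [0] while its integral along a small
   diamond is close to that of [/ (a * z)]. *)
Lemma psi_away : exists d, 0 < d /\ forall z, 1 <= Cmod z -> d <= Cmod (psi z).
Proof.
assert (Ham : 0 < Cmod a) by now apply Cmod_gt_0.
(* With this value the integrand compared below is at most [2 / (7 * r)], so its integral is at most
   [16 / 7], which is less than [4]. *)
set (eta := Cmod a / 16). assert (Heta : 0 < eta) by (unfold eta; lra).
destruct (psi_tangent eta Heta) as [d [Hd Htan]].
(* The bound [d / 2] keeps the diamond where the tangent estimate holds; [1 / 2] leaves [z0]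
   outside, so by injectivity [w] is not attained on the disc. *)
set (r := Rmin (d / 2) (1 / 2)).
assert (Hr : 0 < r) by (apply Rmin_glb_lt; lra).
assert (Hr1 : r <= d / 2) by apply Rmin_l. assert (Hr2 : r <= 1 / 2) by apply Rmin_r.
exists (eta * r / 2). split; [apply Rdiv_lt_0_compat; [now apply Rmult_lt_0_compat|lra]|].
intros z0 Hz0. apply Rnot_lt_le. intros Hw. set (w := psi z0) in *.
assert (Hne : forall z, Cmod z <= r -> (psi z - w)%C <> 0).
{ intros z Hz H. apply Ceq_minus in H. apply Hinj in H. subst z. lra. }
set (f := fun z => (/ (psi z - w))%C).
assert (Hf : forall z, Cmod z <= r -> C_derivable f z).
{ intros z Hz. specialize (Hne z Hz). assert (H := Hpsi z). unfold f. C_derive_tac. }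
assert (Hdisc : convex (fun z => Cmod z <= r)).
{ intros P Q t HP HQ Ht. replace (seg_point P Q t) with (seg_point P Q t - 0)%C by ring.
  apply Cmod_seg_point_le; [exact Ht| |];
    [replace (P - 0)%C with P by ring | replace (Q - 0)%C with Q by ring]; assumption. }
assert (Hf0 : diamond_int f 0 r = 0).
{ apply (diamond_goursat (fun z => Cmod z <= r) f 0 r Hdisc Hf).
  all: rewrite ?Cplus_0_l; unfold Cminus; rewrite ?Cplus_0_l, ?Cmod_opp, ?Cmod_mult, ?Cmod_Ci,
    Cmod_R, Rabs_pos_eq; lra. }
assert (Hinv := diamond_inv 0 r Hr).
assert (Hann : forall z, annulus 0 r z -> z <> 0).
{ intros z Hz. apply annulus_0 in Hz. apply Cmod_gt_0. lra. }
assert (Df : forall z, annulus 0 r z -> C_derivable f z).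
{ intros z Hz. apply Hf. now apply annulus_0 in Hz. }
assert (Dg : forall z, annulus 0 r z -> C_derivable (fun z => / (z - 0))%C z).
{ intros z Hz. now apply C_derivable_cauchy_kernel, Hann. }
(* The integral of [a * f] is [0] and that of [1 / z] is [winding_const], yet the difference of the
   two functions is small. *)
assert (Hlin := diamond_lin f (fun z => / (z - 0))%C a (- (1))%C 0 r Hr Df Dg).
rewrite Hf0, Hinv in Hlin.
assert (Hb := diamond_bound (fun z => a * f z + - (1) * / (z - 0))%C 0 r (2 / (7 * r)) Hr).
rewrite Hlin in Hb.
replace (a * 0 + - (1) * winding_const)%C with (- winding_const)%C in Hb by ring.
rewrite Cmod_opp in Hb. assert (Hc := winding_const_bound).
replace (8 * r * (2 / (7 * r))) with (16 / 7) in Hb by (field; lra).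
apply (Rlt_irrefl 4). eapply Rle_lt_trans; [exact Hc|]. eapply Rle_lt_trans; [apply Hb|lra].
- intros z Hz. apply C_derivable_plus; apply C_derivable_mult; auto using C_derivable_const.
- intros z Hz. assert (Hz' := annulus_0 r z Hz). specialize (Hann z Hz).
  specialize (Hne z (proj2 Hz')). specialize (Htan z ltac:(lra)).
  unfold f. replace (a * / (psi z - w) + - (1) * / (z - 0))%C
    with ((w - (psi z - a * z)) / ((psi z - w) * z))%C
    by (field; repeat split; auto; replace (z - 0)%C with z by ring; auto).
  rewrite Cmod_div by now apply Cmult_neq_0. rewrite Cmod_mult.
  assert (T1 := Cmod_triangle_minus w (psi z - a * z)).
  assert (T2 := Cmod_triangle_rev (a * z) (w - (psi z - a * z))).
  replace (a * z - (w - (psi z - a * z)))%C with (psi z - w)%C in T2 by ring.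
  rewrite Cmod_mult in T2.
  assert (Hnum : Cmod (w - (psi z - a * z)) <= 2 * eta * Cmod z) by nra.
  assert (Hden : 14 * eta * Cmod z <= Cmod (psi z - w)) by (unfold eta in *; nra).
  assert (Hzpos : 0 < Cmod z) by lra.
  assert (Hep : 0 < eta * Cmod z) by now apply Rmult_lt_0_compat.
  apply Rle_div_l; [apply Rmult_lt_0_compat; lra|].
  apply Rle_trans with (2 / (7 * r) * (14 * eta * Cmod z * (r / 2))).
  + replace (2 / (7 * r) * (14 * eta * Cmod z * (r / 2))) with (2 * eta * Cmod z) by (field; lra).
    exact Hnum.
  + apply Rmult_le_compat_l; [apply Rlt_le, Rdiv_lt_0_compat; lra|].
    apply Rmult_le_compat; lra.
Qed.

(* At [0] the quotient is [0 * / 0 = 0], which is also the limit. *)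
Lemma entire_sqr_div_psi : entire (fun z => z * z / psi z)%C.
Proof.
intros z. destruct (Ceq_dec z 0) as [->|Hz].
2:{ assert (H := psi_nz z Hz). assert (H' := Hpsi z). C_derive_tac. }
assert (Ham : 0 < Cmod a) by now apply Cmod_gt_0.
exists (/ a)%C. apply is_C_derive_iff. intros eps Heps.
(* The first bound gives [Cmod (psi y) >= Cmod a / 2 * Cmod y]; the second makes the resulting
   quotient at most [eps]. *)
set (eta := Rmin (Cmod a / 2) (eps * Cmod a ^ 2 / 2)).
assert (Heta : 0 < eta).
{ apply Rmin_glb_lt; [lra|]. assert (H := pow_lt _ 2 Ham). nra. }
assert (Heta1 : eta <= Cmod a / 2) by apply Rmin_l.
assert (Heta2 : eta <= eps * Cmod a ^ 2 / 2) by apply Rmin_r.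
destruct (psi_tangent eta Heta) as [d [Hd Htan]].
exists d. split; [exact Hd|]. intros y Hy.
replace (y - 0)%C with y in * by ring.
destruct (Ceq_dec y 0) as [->|Hy0].
{ match goal with |- Cmod ?X <= _ => replace X with (RtoC 0) by ring end.
  rewrite Cmod_0. lra. }
specialize (Htan y Hy). assert (Hnz := psi_nz y Hy0).
replace (y * y / psi y - 0 * 0 / psi 0 - y * / a)%C with (y * (- (psi y - a * y) / (psi y * a)))%C.
2:{ replace (0 * 0 / psi 0)%C with (RtoC 0) by (unfold Cdiv; ring). field. auto. }
rewrite Cmod_mult, Rmult_comm. apply Rmult_le_compat_r; [apply Cmod_ge_0|].
rewrite Cmod_div by now apply Cmult_neq_0. rewrite Cmod_opp, Cmod_mult.
assert (Hyp : 0 < Cmod y) by now apply Cmod_gt_0.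
assert (T := Cmod_triangle_rev (a * y) (- (psi y - a * y))).
replace (a * y - - (psi y - a * y))%C with (psi y) in T by ring.
rewrite Cmod_opp, Cmod_mult in T.
assert (Hlow : Cmod a / 2 * Cmod y <= Cmod (psi y)) by nra.
assert (Hlow0 : 0 < Cmod a / 2 * Cmod y) by (apply Rmult_lt_0_compat; lra).
apply Rle_div_l; [apply Rmult_lt_0_compat; lra|].
apply Rle_trans with (eps * (Cmod a / 2 * Cmod y * Cmod a)).
- eapply Rle_trans; [exact Htan|]. simpl in Heta2. nra.
- apply Rmult_le_compat_l; [lra|]. apply Rmult_le_compat_r; lra.
Qed.

(** The quadratic form of [z ^ 2 / psi z] gives [psi z * (al * z + be) = z] off [0]. If [al <> 0],
    the root [- be / al] contradicts this when [be <> 0], and for [be = 0] the function [psi] would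
    be constant off [0]. *)
Lemma psi_linear : exists b : C, b <> 0 /\ forall z, psi z = (b * z)%C.
Proof.
destruct psi_away as [d [Hd Hlow]].
destruct (liouville_quadratic (fun z => z * z / psi z)%C (/ d) entire_sqr_div_psi) as [al [be Hk]].
- unfold Cdiv. ring.
- intros z Hz. specialize (Hlow z Hz).
  assert (Hp : psi z <> 0) by (apply Cmod_gt_0; lra).
  rewrite Cmod_div by exact Hp. rewrite Cmod_mult.
  replace (Cmod z * Cmod z) with (Cmod z ^ 2) by ring. unfold Rdiv. rewrite Rmult_comm.
  apply Rmult_le_compat_r; [apply pow2_ge_0|]. now apply Rinv_le_contravar.
- assert (Hmain : forall z : C, z <> 0 -> (psi z * (al * z + be))%C = z).
  { intros z Hz. assert (Hp := psi_nz z Hz). specialize (Hk z).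
    replace (al * z + be)%C with ((al * (z * z) + be * z) / z)%C by (field; exact Hz).
    rewrite <- Hk. field. auto. }
  destruct (Ceq_dec al 0) as [->|Hal].
  + assert (Hbe : be <> 0).
    { intros ->. specialize (Hmain 1 C1_nz). apply C1_nz.
      rewrite <- Hmain. ring. }
    exists (/ be)%C. split.
    * intros H. apply (f_equal (Cmult be)) in H. rewrite Cinv_r in H by exact Hbe.
      apply C1_nz. rewrite H. ring.
    * intros z. destruct (Ceq_dec z 0) as [->|Hz]; [rewrite H0; ring|].
      specialize (Hmain z Hz).
      replace (psi z) with (psi z * (0 * z + be) / be)%C by (field; exact Hbe).
      rewrite Hmain. field. exact Hbe.
  + exfalso. destruct (Ceq_dec be 0) as [->|Hbe].
    * assert (Hc : forall z : C, z <> 0 -> psi z = (/ al)%C).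
      { intros z Hz. specialize (Hmain z Hz).
        replace (psi z) with (psi z * (al * z + 0) / (al * z))%C by (field; auto).
        rewrite Hmain. field. auto. }
      assert (H2 : RtoC 2 <> 0) by (intros H; apply RtoC_inj in H; lra).
      assert (H12 : RtoC 1 = RtoC 2) by (apply Hinj; rewrite !Hc; auto using C1_nz).
      apply RtoC_inj in H12. lra.
    * assert (Hz : (- be / al)%C <> 0).
      { intros H. apply Hbe. replace be with (- (al * (- be / al)))%C by (field; exact Hal).
        rewrite H. ring. }
      apply Hz. specialize (Hmain _ Hz).
      rewrite <- Hmain. field. exact Hal.
Qed.

End Normalized.

(** Restricted to the real interval from [0] to [1], [f] has zero derivative. Two points suffice to
    contradict injectivity. *)
Lemma derive_zero_const (f : C -> C) : (forall z, is_C_derive f z (RtoC 0)) -> f 0 = f 1.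
Proof.
intros Hf.
apply (eq_is_derive (V := C_R_NormedModule) (fun t => f (RtoC t)) 0 1); [|lra].
intros t _. split; [apply (is_linear_scal_l (K := R_AbsRing) (V := C_R_NormedModule))|].
intros x Hx eps.
replace x with t.
2:{ apply (is_filter_lim_locally_unique (K := R_AbsRing) (V := R_NormedModule)). exact Hx. }
destruct (proj1 (is_C_derive_iff _ _ _) (Hf (RtoC t)) eps (cond_pos eps)) as [d [Hd H]].
exists (mkposreal d Hd). intros s Hs.
change (Rabs (s - t) < d) in Hs. specialize (H (RtoC s)).
rewrite <- RtoC_minus, Cmod_R in H. specialize (H Hs).
change (sqrt (Rabs (fst (minus (minus (f s) (f t)) (scal (s - t) zero))) ^ 2 +
  Rabs (snd (minus (minus (f s) (f t)) (scal (s - t) zero))) ^ 2) <= eps * Rabs (s - t)).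
rewrite !pow2_abs. eapply Rle_trans; [|exact H]. apply Req_le.
unfold Cmod. f_equal. f_equal; f_equal.
all: simpl; unfold minus, plus, opp, scal, zero; simpl; unfold mult; simpl; ring.
Qed.

Lemma injective_entire_affine (phi : C -> C) :
  entire phi -> (forall x y, phi x = phi y -> x = y) ->
  exists a b : C, a <> 0 /\ forall z, phi z = (a * z + b)%C.
Proof.
intros Hphi Hinj.
(* Some derivative is non-zero, since otherwise [phi 0 = phi 1]; moving that point and its value to
   [0] gives [psi]. *)
destruct (Classical_Prop.classic (exists z l : C, l <> 0 /\ is_C_derive phi z l)) as [[z0 [l [Hl Hd]]]|Hno].
- set (psi := fun z => (phi (z + z0) - phi z0)%C).
  assert (Hz0 : (0 + z0)%C = z0) by ring.
  destruct (psi_linear psi l) as [b [Hb Hlin]].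
  + intros z. unfold psi. apply C_derivable_minus; [|apply C_derivable_const].
    apply (C_derivable_comp phi); [apply Hphi|]. C_derive_tac.
  + intros x y H. unfold psi in H.
    assert (H1 : phi (x + z0)%C = phi (y + z0)%C).
    { replace (phi (x + z0)%C) with (phi (x + z0) - phi z0 + phi z0)%C by ring. rewrite H. ring. }
    apply Hinj in H1. replace x with (x + z0 - z0)%C by ring. rewrite H1. ring.
  + unfold psi. rewrite Hz0. ring.
  + exact Hl.
  + apply is_C_derive_iff. intros eps Heps.
    destruct (proj1 (is_C_derive_iff _ _ _) Hd eps Heps) as [d [Hd0 H]].
    exists d. split; [exact Hd0|]. intros y Hy. unfold psi. rewrite Hz0.
    specialize (H (y + z0)%C). replace (y - 0)%C with (y + z0 - z0)%C in * by ring.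
    replace (phi (y + z0) - phi z0 - (phi z0 - phi z0))%C with (phi (y + z0) - phi z0)%C by ring.
    now apply H.
  + exists b, (phi z0 - b * z0)%C. split; [exact Hb|]. intros z.
    specialize (Hlin (z - z0)%C). unfold psi in Hlin.
    replace (z - z0 + z0)%C with z in Hlin by ring.
    replace (phi z) with (phi z - phi z0 + phi z0)%C by ring. rewrite Hlin. ring.
- exfalso. apply C1_nz. symmetry. apply Hinj, derive_zero_const.
  intros z. destruct (Hphi z) as [l Hl]. destruct (Ceq_dec l 0) as [->|Hl0]; [exact Hl|].
  exfalso. apply Hno. now exists z, l.
Qed.

(** * Recurrence *)

Lemma iter_comp_op (phi f : C -> C) (k : nat) (z : C) :
  Nat.iter k (comp_op phi) f z = f (Nat.iter k phi z).
Proof.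
revert z. induction k as [|k IH]; intros z; [reflexivity|].
change (Nat.iter k (comp_op phi) f (phi z) = f (Nat.iter (S k) phi z)).
now rewrite IH, Nat.iter_succ_r.
Qed.

Lemma entire_iter (phi f : C -> C) (k : nat) :
  entire phi -> entire f -> entire (Nat.iter k (comp_op phi) f).
Proof.
intros Hphi Hf. induction k as [|k IH]; [exact Hf|].
intros z. apply (C_derivable_comp (Nat.iter k (comp_op phi) f) phi); [apply IH|apply Hphi].
Qed.

(** Recurrence need only be tested on basic neighbourhoods, which turns it into an approximation
    problem on discs. *)
Lemma recurrent_iff_approx (phi : C -> C) : entire phi ->
  recurrent_comp phi <->
  forall f, entire f -> forall r eps, 0 < eps ->
    exists k g, (1 <= k)%nat /\ entire g /\
      forall z, Cmod z <= r ->
        Cmod (g z - f z) <= eps /\ Cmod (g (Nat.iter k phi z) - f z) <= eps.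
Proof.
intros Hphi. split.
- intros Hrec f Hf r eps Heps.
  (* A uniform bound [e] strictly below [eps] makes this set open: half of the gap [eps - e] is the
     room left for a perturbation. *)
  destruct (Hrec (fun g => exists e, e < eps /\ forall z, Cmod z <= r -> Cmod (g z - f z) <= e))
    as [k [Hk [g [Hg [[e1 [He1 H1]] [e2 [He2 H2]]]]]]].
  + intros g _ [e [He H]]. exists r, ((eps - e) / 2). split; [lra|].
    intros h _ Hh. exists ((eps + e) / 2). split; [lra|]. intros z Hz.
    specialize (H z Hz). specialize (Hh z Hz).
    assert (T := Cmod_minus_triangle (h z) (g z) (f z)). lra.
  + exists f. split; [exact Hf|]. exists 0. split; [exact Heps|]. intros z _.
    replace (f z - f z)%C with (RtoC 0) by ring. rewrite Cmod_0. lra.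
  + exists k, g. repeat split; [exact Hk|exact Hg| |].
    * specialize (H1 z H). lra.
    * specialize (H2 z H). rewrite iter_comp_op in H2. lra.
- intros Happ U HU [f [Hf HUf]].
  destruct (HU f Hf HUf) as [r [eps [Heps HN]]].
  destruct (Happ f Hf r eps Heps) as [k [g [Hk [Hg H]]]].
  exists k. split; [exact Hk|]. exists g. split; [exact Hg|]. split.
  + apply HN; [exact Hg|]. intros z Hz. now apply H.
  + apply HN; [now apply entire_iter|]. intros z Hz. rewrite iter_comp_op. now apply H.
Qed.

(** As [k >= 1], the two points have the same [k]-th image, and the value of [g] there is close to
    both. *)
Lemma recurrent_injective (phi : C -> C) :
  entire phi -> recurrent_comp phi -> forall x y, phi x = phi y -> x = y.
Proof.
intros Hphi Hrec x y Hxy.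
apply Cmod_minus_0, Rle_antisym; [|apply Cmod_ge_0].
apply le_epsilon. intros eps Heps. rewrite Rplus_0_l.
destruct (proj1 (recurrent_iff_approx phi Hphi) Hrec (fun z => z) C_derivable_id
  (Rmax (Cmod x) (Cmod y)) (eps / 2) ltac:(lra)) as [k [g [Hk [_ H]]]].
assert (Hx := proj2 (H x (Rmax_l _ _))). assert (Hy := proj2 (H y (Rmax_r _ _))).
assert (Hit : Nat.iter k phi x = Nat.iter k phi y).
{ destruct k as [|k]; [lia|]. rewrite !Nat.iter_succ_r. now rewrite Hxy. }
rewrite Hit, Cmod_minus_sym in Hx.
assert (T := Cmod_minus_triangle x (g (Nat.iter k phi y)) y). lra.
Qed.

Lemma iter_affine (phi : C -> C) (a c : C) (k : nat) (z : C) :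
  (forall z, phi z = c + a * (z - c))%C -> Nat.iter k phi z = (c + a ^ k * (z - c))%C.
Proof.
intros H. induction k as [|k IH].
- simpl. ring.
- simpl Nat.iter. rewrite H, IH, Cpow_S. ring.
Qed.

Lemma recurrent_affine_modulus (phi : C -> C) (a b : C) :
  entire phi -> recurrent_comp phi -> a <> 0 -> (forall z, phi z = a * z + b)%C -> Cmod a = 1.
Proof.
intros Hphi Hrec Ha Haff.
destruct (Req_dec (Cmod a) 1) as [H1|H1]; [exact H1|exfalso].
assert (Ham : 0 < Cmod a) by now apply Cmod_gt_0.
assert (Ha1 : (1 - a)%C <> 0).
{ intros H. apply H1. apply Ceq_minus in H. rewrite <- H. apply Cmod_1. }
set (c := (b / (1 - a))%C).
assert (Hfix : forall z, (phi z = c + a * (z - c))%C)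
  by (intros z; rewrite Haff; unfold c; field; exact Ha1).
(* The contraction factor of [phi] or of its inverse, whichever contracts. *)
set (q := Rmin (Cmod a) (/ Cmod a)).
assert (Hia : 0 < / Cmod a) by now apply Rinv_0_lt_compat.
assert (Hprod : Cmod a * / Cmod a = 1) by (field; lra).
assert (Hq0 : 0 < q) by now apply Rmin_glb_lt.
assert (Hq : q < 1).
{ unfold q, Rmin. destruct Rle_dec as [Hle|Hle]; nra. }
(* The disc contains the unit disc about [c], and two errors of [(1 - q) / 4] stay below [1 - q]. *)
destruct (proj1 (recurrent_iff_approx phi Hphi) Hrec (fun z => z) C_derivable_id
  (Cmod c + 1) ((1 - q) / 4) ltac:(lra)) as [k [g [Hk [_ H]]]].
(* Where [g] is close to the identity, a point and its [k]-th image are close. *)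
assert (Hpair : forall x : C, Cmod x <= q -> forall s t : C, (s = 1 /\ t = x) \/ (s = x /\ t = 1) ->
  Nat.iter k phi (c + s)%C = (c + t)%C -> False).
{ intros x Hx s t Hst Hit.
  assert (Hs : Cmod s <= 1) by (destruct Hst as [[-> _]|[-> _]]; rewrite ?Cmod_1; lra).
  assert (Ht : Cmod t <= 1) by (destruct Hst as [[_ ->]|[_ ->]]; rewrite ?Cmod_1; lra).
  assert (Hs' := proj2 (H (c + s)%C ltac:(assert (T := Cmod_triangle c s); lra))).
  assert (Ht' := proj1 (H (c + t)%C ltac:(assert (T := Cmod_triangle c t); lra))).
  rewrite Hit, Cmod_minus_sym in Hs'.
  assert (T := Cmod_minus_triangle (c + s) (g (c + t)%C) (c + t)).
  replace (c + s - (c + t))%C with (s - t)%C in T by ring.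
  assert (Hd : 1 - q <= Cmod (s - t)).
  { assert (T' := Cmod_triangle_rev 1 x). rewrite Cmod_1 in T'.
    destruct Hst as [[-> ->]|[-> ->]]; [|rewrite Cmod_minus_sym]; lra. }
  lra. }
assert (Hpow : forall x, 0 < x <= 1 -> x ^ k <= x).
{ intros x Hx. destruct k as [|k']; [lia|]. simpl.
  assert (Hp : x ^ k' <= 1 ^ k') by (apply pow_incr; lra). rewrite pow1 in Hp. nra. }
assert (Hak : (a ^ k)%C <> 0) by now apply Cpow_nz.
(* If [phi] contracts, [c + 1] goes to [c + a ^ k]; if it expands, [c + / a ^ k] goes to [c + 1]. *)
destruct (Rle_lt_dec (Cmod a) 1) as [Hle|Hgt].
- apply (Hpair (a ^ k)%C) with (s := RtoC 1) (t := (a ^ k)%C); [|now left|].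
  + rewrite Cmod_pow. eapply Rle_trans; [apply Hpow; lra|].
    unfold q. apply Rmin_glb; [lra|nra].
  + rewrite (iter_affine phi a c) by exact Hfix. ring.
- apply (Hpair (/ a ^ k)%C) with (s := (/ a ^ k)%C) (t := RtoC 1); [|now right|].
  + rewrite Cmod_inv, Cmod_pow, <- pow_inv by exact Hak.
    assert (Hi1 : / Cmod a <= 1) by nra.
    eapply Rle_trans; [apply Hpow; lra|]. unfold q. apply Rmin_glb; lra.
  + rewrite (iter_affine phi a c) by exact Hfix. field. exact Hak.
Qed.

(** * Compactness of discs and recurrence of rotations *)

(** Real and imaginary parts are uniformly continuous on the square around the disc. *)
Lemma entire_uniformly_continuous (f : C -> C) (r eps : R) : entire f -> 0 < eps ->
  exists d, 0 < d /\ forall x y, Cmod x <= r -> Cmod y <= r -> Cmod (y - x) < d ->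
    Cmod (f y - f x) < eps.
Proof.
intros Hf Heps.
assert (Hcont : forall x y e, 0 < e -> exists d : posreal, forall u v,
  Rabs (u - x) < d -> Rabs (v - y) < d -> Cmod (f (u, v) - f (x, y)) < e).
{ intros x y e He. destruct (C_derivable_continuous f (x, y) (Hf _) e He) as [d [Hd H]].
  exists (mkposreal (d / 2) ltac:(lra)). intros u v Hu Hv. simpl in Hu, Hv. apply H.
  eapply Rle_lt_trans; [apply Cmod_le_sum|]. simpl. unfold Rminus in Hu, Hv. lra. }
assert (He2 : 0 < eps / 2) by lra.
destruct (uniform_continuity_2d (fun x y => fst (f (x, y))) (- r) r (- r) r) with (mkposreal _ He2)
  as [d1 H1].
{ intros x y _ _ e. destruct (Hcont x y e (cond_pos e)) as [d Hd]. exists d. intros u v Hu Hv.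
  eapply Rle_lt_trans; [apply (proj1 (Cmod_coords (f (u, v) - f (x, y))%C))|]. now apply Hd. }
destruct (uniform_continuity_2d (fun x y => snd (f (x, y))) (- r) r (- r) r) with (mkposreal _ He2)
  as [d2 H2].
{ intros x y _ _ e. destruct (Hcont x y e (cond_pos e)) as [d Hd]. exists d. intros u v Hu Hv.
  eapply Rle_lt_trans; [apply (proj2 (Cmod_coords (f (u, v) - f (x, y))%C))|]. now apply Hd. }
exists (Rmin d1 d2). split; [apply Rmin_glb_lt; apply cond_pos|].
intros [x1 x2] [y1 y2] Hx Hy Hd.
destruct (Cmod_coords (x1, x2)) as [Hx1 Hx2]. destruct (Cmod_coords (y1, y2)) as [Hy1 Hy2].
destruct (Cmod_coords ((y1, y2) - (x1, x2))%C) as [Hd1 Hd2]. simpl in *.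
assert (Hm1 := Rmin_l d1 d2). assert (Hm2 := Rmin_r d1 d2).
assert (Hbox : forall t, Rabs t <= r -> - r <= t <= r) by (intros t Ht; now apply Rabs_le_between).
specialize (H1 x1 x2 y1 y2). specialize (H2 x1 x2 y1 y2).
unfold Rminus in *.
eapply Rle_lt_trans; [apply Cmod_le_sum|]. simpl.
assert (A1 := H1 ltac:(apply Hbox; lra) ltac:(apply Hbox; lra) ltac:(apply Hbox; lra) ltac:(apply Hbox; lra)
  ltac:(lra) ltac:(lra)).
assert (A2 := H2 ltac:(apply Hbox; lra) ltac:(apply Hbox; lra) ltac:(apply Hbox; lra) ltac:(apply Hbox; lra)
  ltac:(lra) ltac:(lra)).
lra.
Qed.

(** The radius from [0] to [z] is walked in boundedly many steps of length at most [d / 2], each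
    changing [f] by less than [1]. *)
Lemma entire_bounded (f : C -> C) (r : R) : entire f ->
  exists M, 0 <= M /\ forall z, Cmod z <= r -> Cmod (f z) <= M.
Proof.
intros Hf. destruct (entire_uniformly_continuous f r 1 Hf Rlt_0_1) as [d [Hd Hu]].
assert (Hstep : forall n z, Cmod z <= r -> Cmod z <= INR n * (d / 2) ->
  Cmod (f z) <= Cmod (f 0) + INR n).
{ intros n. induction n as [|n IH]; intros z Hz Hn.
  - simpl in Hn. rewrite (Cmod_eq_0 z) by (assert (H := Cmod_ge_0 z); lra). simpl. lra.
  - rewrite S_INR in *. assert (Hn0 := pos_INR n).
    (* Shrinking [z] by this factor brings it within [n] steps of [0] and moves it by at most
       [d / 2]. *)
    set (t := INR n / (INR n + 1)).
    assert (Ht : 0 <= t <= 1).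
    { unfold t. split; [apply Rdiv_le_0_compat; lra|]. apply Rle_div_l; lra. }
    assert (Ht1 : t * (INR n + 1) = INR n) by (unfold t; field; lra).
    assert (Hz0 := Cmod_ge_0 z).
    assert (Hm : Cmod (RtoC t * z) = t * Cmod z) by (rewrite Cmod_mult, Cmod_R, Rabs_pos_eq; lra).
    assert (H1 : Cmod (f (RtoC t * z)%C) <= Cmod (f 0) + INR n).
    { apply IH; rewrite Hm; [nra|]. nra. }
    assert (H2 : Cmod (f z - f (RtoC t * z)%C) < 1).
    { apply Hu; [rewrite Hm; nra|exact Hz|].
      replace (z - RtoC t * z)%C with (RtoC (1 - t) * z)%C by (rewrite RtoC_minus; ring).
      rewrite Cmod_mult, Cmod_R, Rabs_pos_eq by lra. nra. }
    assert (T := Cmod_triangle_rev (f z) (f (RtoC t * z)%C)). lra. }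
destruct (nfloor_ex (Rmax 0 (r / (d / 2)))) as [n [_ Hn]]; [apply Rmax_l|].
exists (Cmod (f 0) + INR (S n)). split.
{ apply Rplus_le_le_0_compat; [apply Cmod_ge_0|apply pos_INR]. }
intros z Hz. apply Hstep; [exact Hz|]. rewrite S_INR.
assert (H := Rle_lt_trans _ _ _ (Rmax_r _ _) Hn). apply Rlt_div_l in H; lra.
Qed.

Lemma pigeonhole (A : Type) (f : nat -> A) (l : list A) :
  (forall i, In (f i) l) -> exists i j, (i < j)%nat /\ f i = f j.
Proof.
intros Hf. apply Classical_Prop.NNPP. intros Hno.
assert (Hinj : Injective f).
{ intros i j Hij. destruct (Nat.lt_total i j) as [H|[H|H]]; [|exact H|];
    exfalso; apply Hno; eauto. }
assert (H := NoDup_incl_length (l' := l)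
  (Injective_map_NoDup Hinj (seq_NoDup (S (length l)) 0))).
rewrite length_map, length_seq in H.
assert (H' : incl (map f (seq 0 (S (length l)))) l).
{ intros x Hx. apply in_map_iff in Hx. destruct Hx as [i [<- _]]. apply Hf. }
specialize (H H'). lia.
Qed.

(** Two powers [a ^ i] and [a ^ j] fall into the same small box of the square around the unit
    circle; dividing by [a ^ i] preserves their distance. *)
Lemma unimodular_power_near_1 (a : C) (eps : R) : Cmod a = 1 -> 0 < eps ->
  exists k, (1 <= k)%nat /\ Cmod (a ^ k - 1) < eps.
Proof.
intros Ha Heps.
assert (Hmod : forall n, Cmod (a ^ n) = 1) by (intros n; rewrite Cmod_pow, Ha; apply pow1).
(* The boxes have side [/ K = eps / 2], so both coordinates together contribute less than [eps]. *)
set (K := 2 / eps). assert (HK : 0 < K) by (apply Rdiv_lt_0_compat; lra).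
destruct (nfloor_ex (2 * K)) as [N [_ HN]]; [lra|].
assert (Hfl : forall x, Rabs x <= 1 -> exists m, In m (seq 0 (S N)) /\
  INR m <= (x + 1) * K < INR m + 1).
{ intros x Hx. apply Rabs_le_between in Hx.
  destruct (nfloor_ex ((x + 1) * K)) as [m Hm]; [nra|]. exists m. split; [|exact Hm].
  apply in_seq. split; [lia|]. apply INR_lt. rewrite plus_INR, S_INR. simpl.
  apply Rle_lt_trans with (2 * K); [nra|lra]. }
destruct (functional_choice (fun (n : nat) (p : nat * nat) =>
  In p (list_prod (seq 0 (S N)) (seq 0 (S N))) /\
  INR (fst p) <= (fst (a ^ n)%C + 1) * K < INR (fst p) + 1 /\
  INR (snd p) <= (snd (a ^ n)%C + 1) * K < INR (snd p) + 1)) as [box Hbox].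
{ intros n. destruct (Cmod_coords (a ^ n)%C) as [H1 H2]. rewrite Hmod in H1, H2.
  destruct (Hfl _ H1) as [m1 [Hin1 Hm1]]. destruct (Hfl _ H2) as [m2 [Hin2 Hm2]].
  exists (m1, m2). repeat split; try (apply in_prod; assumption); simpl; lra. }
destruct (pigeonhole _ box _ (fun n => proj1 (Hbox n))) as [i [j [Hij Hb]]].
exists (j - i)%nat. split; [lia|].
destruct (Hbox i) as [_ [Hi1 Hi2]]. destruct (Hbox j) as [_ [Hj1 Hj2]].
rewrite Hb in Hi1, Hi2.
assert (Hd : Cmod (a ^ j - a ^ i) < eps).
{ eapply Rle_lt_trans; [apply Cmod_le_sum|].
  change (fst (a ^ j - a ^ i)%C) with (fst (a ^ j)%C - fst (a ^ i)%C).
  change (snd (a ^ j - a ^ i)%C) with (snd (a ^ j)%C - snd (a ^ i)%C).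
  assert (HKe : / K = eps / 2) by (unfold K; field; lra).
  assert (Hb1 : forall x y m, INR m <= (x + 1) * K < INR m + 1 ->
    INR m <= (y + 1) * K < INR m + 1 -> Rabs (x - y) < eps / 2).
  { intros x y m Hx Hy. rewrite <- HKe. apply Rabs_def1.
    - apply Rmult_lt_reg_r with K; [exact HK|]. rewrite Rinv_l by lra. lra.
    - apply Rmult_lt_reg_r with K; [exact HK|].
      replace (- / K * K) with (-1) by (field; lra). lra. }
  assert (P1 := Hb1 _ _ _ Hj1 Hi1). assert (P2 := Hb1 _ _ _ Hj2 Hi2). lra. }
replace (a ^ j)%C with (a ^ i * a ^ (j - i))%C in Hd by (rewrite <- Cpow_add_r; f_equal; lia).
replace (a ^ i * a ^ (j - i) - a ^ i)%C with (a ^ i * (a ^ (j - i) - 1))%C in Hd by ring.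
rewrite Cmod_mult, Hmod in Hd. lra.
Qed.

(** The function [f] itself serves as [g], for a [k] such that the [k]-th iterate is uniformly close
    to the identity on the disc. *)
Lemma rotation_recurrent (phi : C -> C) (a c : C) :
  entire phi -> Cmod a = 1 -> (forall z, phi z = c + a * (z - c))%C -> recurrent_comp phi.
Proof.
intros Hphi Ha Hrot. apply recurrent_iff_approx; [exact Hphi|].
intros f Hf r eps Heps.
(* This radius also contains the image of the disc under rotations about [c]. *)
destruct (entire_uniformly_continuous f (r + 2 * Cmod c) eps Hf Heps) as [d [Hd Hu]].
assert (Hc := Cmod_ge_0 c). assert (Hr := Rabs_pos r).
set (L := Rabs r + Cmod c + 1).
destruct (unimodular_power_near_1 a (d / L) Ha) as [k [Hk Hak]].
{ apply Rdiv_lt_0_compat; unfold L; lra. }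
apply Rlt_div_r in Hak; [|unfold L; lra].
exists k, f. split; [exact Hk|]. split; [exact Hf|]. intros z Hz. split.
- replace (f z - f z)%C with (RtoC 0) by ring. rewrite Cmod_0. lra.
- rewrite (iter_affine phi a c) by exact Hrot. apply Rlt_le.
  assert (Hzc := Cmod_triangle_minus z c).
  apply Hu; [lra| |].
  + assert (T := Cmod_triangle c (a ^ k * (z - c))).
    rewrite Cmod_mult, Cmod_pow, Ha, pow1 in T. lra.
  + replace (c + a ^ k * (z - c) - z)%C with ((a ^ k - 1) * (z - c))%C by ring.
    rewrite Cmod_mult. eapply Rle_lt_trans; [|exact Hak].
    apply Rmult_le_compat_l; [apply Cmod_ge_0|].
    assert (Hr' := Rle_abs r). unfold L. lra.
Qed.

(** * Recurrence of translations *)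

(* A polynomial with superattracting fixed points [0] and [1]; its iterates
   separate a neighbourhood of [0] from one of [1]. *)
Definition switch (u : C) : C := (3 * (u * u) - 2 * (u * u * u))%C.

Lemma switch_sym (u : C) : switch (1 - u) = (1 - switch u)%C.
Proof. unfold switch. ring. Qed.

Lemma entire_switch_iter (n : nat) : entire (Nat.iter n switch).
Proof.
induction n as [|n IH]; intros z; [apply C_derivable_id|].
apply (C_derivable_comp switch (Nat.iter n switch)); [|apply IH].
unfold switch. C_derive_tac.
Qed.

(** For [Cmod v <= 1 / 8], [3 * Cmod v ^ 2 + 2 * Cmod v ^ 3] is at most [Cmod v / 2]. *)
Lemma switch_iter_near_0 (n : nat) (u : C) :
  Cmod u <= 1 / 8 -> Cmod (Nat.iter n switch u) <= (1 / 2) ^ n * (1 / 8).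
Proof.
intros Hu. induction n as [|n IH]; [simpl; lra|].
simpl Nat.iter. set (v := Nat.iter n switch u) in *.
assert (Hv : Cmod v <= 1 / 8).
{ eapply Rle_trans; [exact IH|].
  assert (H : (1 / 2) ^ n <= 1 ^ n) by (apply pow_incr; lra). rewrite pow1 in H. lra. }
assert (Hv0 := Cmod_ge_0 v).
apply Rle_trans with (1 / 2 * Cmod v); [|simpl; lra].
unfold switch. eapply Rle_trans; [apply Cmod_triangle_minus|].
rewrite !Cmod_mult, !Cmod_R, !Rabs_pos_eq by lra. nra.
Qed.

(** The reflection [u -> 1 - u] commutes with [switch] and exchanges its two fixed points. *)
Lemma switch_iter_near_1 (n : nat) (u : C) :
  Cmod u <= 1 / 8 -> Cmod (1 - Nat.iter n switch (1 + u)%C) <= (1 / 2) ^ n * (1 / 8).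
Proof.
intros Hu.
assert (H : forall v, Nat.iter n switch (1 - v)%C = (1 - Nat.iter n switch v)%C).
{ intros v. induction n as [|n IH]; [reflexivity|]. simpl. rewrite IH. apply switch_sym. }
replace (1 + u)%C with (1 - - u)%C by ring. rewrite H.
replace (1 - (1 - Nat.iter n switch (- u)%C))%C with (Nat.iter n switch (- u)%C) by ring.
apply switch_iter_near_0. now rewrite Cmod_opp.
Qed.

Lemma iter_translation (phi : C -> C) (b : C) (k : nat) (z : C) :
  (forall z, phi z = z + b)%C -> Nat.iter k phi z = (z + RtoC (INR k) * b)%C.
Proof.
intros H. induction k as [|k IH].
- simpl. ring.
- rewrite S_INR, RtoC_plus. simpl Nat.iter. rewrite H, IH. ring.
Qed.

(** With [c = k * b], the iterated [h] is close to [0] on the disc and to [1] on its translate by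
    [c], so [g] is close to [f] on the former and to [f (z - c)] on the latter. *)
Lemma translation_recurrent (phi : C -> C) (b : C) :
  entire phi -> b <> 0 -> (forall z, phi z = z + b)%C -> recurrent_comp phi.
Proof.
intros Hphi Hb Htr. apply recurrent_iff_approx; [exact Hphi|].
intros f Hf r eps Heps.
assert (Hbm : 0 < Cmod b) by now apply Cmod_gt_0.
(* The choice of [k] gives [8 * Rabs r < Cmod c], so [z / c] has modulus at most [1 / 8] on the
   disc. *)
destruct (nfloor_ex (8 * Rabs r / Cmod b)) as [k0 [_ Hk0]].
{ apply Rdiv_le_0_compat; [|exact Hbm]. assert (H := Rabs_pos r). lra. }
apply Rlt_div_l in Hk0; [|exact Hbm]. rewrite <- S_INR in Hk0. set (k := S k0) in *.
assert (Hkpos : 0 < INR k) by (apply lt_0_INR; unfold k; lia).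
set (c := (RtoC (INR k) * b)%C).
assert (Hcm : Cmod c = INR k * Cmod b) by (unfold c; rewrite Cmod_mult, Cmod_R, Rabs_pos_eq; lra).
assert (Hc : c <> 0) by (apply Cmod_gt_0; rewrite Hcm; now apply Rmult_lt_0_compat).
assert (Hcpos : 0 < Cmod c) by now apply Cmod_gt_0.
(* A disc containing [z], [z - c] and [z + c] whenever [Cmod z <= r]. *)
destruct (entire_bounded f (r + Cmod c) Hf) as [M [HM0 HM]].
(* The gluing error is at most [(1 / 2) ^ n * (1 / 8) * (2 * M)]; [+ 1] covers [M = 0]. *)
destruct (pow_half_small (eps / (2 * M + 1))) as [n Hn]; [apply Rdiv_lt_0_compat; lra|].
apply Rlt_div_r in Hn; [|lra].
assert (Hpn : 0 < (1 / 2) ^ n) by (apply pow_lt; lra).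
set (h := fun z => Nat.iter n switch (z / c)%C).
exists k, (fun z => f z * (1 - h z) + f (z - c) * h z)%C.
split; [unfold k; lia|]. split.
- intros z. assert (Hh : C_derivable h z).
  { apply (C_derivable_comp (Nat.iter n switch)); [apply entire_switch_iter|]. C_derive_tac. }
  assert (Hfz := Hf z).
  assert (Hfc : C_derivable (fun t => f (t - c)%C) z)
    by (apply (C_derivable_comp f); [apply Hf|C_derive_tac]).
  apply C_derivable_plus; apply C_derivable_mult; try assumption. C_derive_tac.
- intros z Hz. rewrite (iter_translation phi b) by exact Htr. fold c.
  assert (Hu : Cmod (z / c) <= 1 / 8).
  { rewrite Cmod_div by exact Hc. apply Rle_div_l; [exact Hcpos|].
    assert (H := Rle_abs r). lra. }
  assert (Bz : Cmod (f z) <= M) by (apply HM; lra).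
  assert (Bm : Cmod (f (z - c)%C) <= M)
    by (apply HM; eapply Rle_trans; [apply Cmod_triangle_minus|lra]).
  assert (Bp : Cmod (f (z + c)%C) <= M)
    by (apply HM; eapply Rle_trans; [apply Cmod_triangle|lra]).
  assert (Hfin : forall x y t, Cmod x <= M -> Cmod y <= M -> Cmod t <= (1 / 2) ^ n * (1 / 8) ->
    Cmod (t * (x - y)) <= eps).
  { intros x y t Hx Hy Ht. rewrite Cmod_mult.
    assert (T := Cmod_triangle_minus x y).
    apply Rle_trans with ((1 / 2) ^ n * (1 / 8) * (2 * M)).
    - apply Rmult_le_compat; try apply Cmod_ge_0; lra.
    - nra. }
  split.
  + replace (f z * (1 - h z) + f (z - c) * h z - f z)%C with (h z * (f (z - c) - f z))%C by ring.
    apply Hfin; try assumption. now apply switch_iter_near_0.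
  + replace (z + c - c)%C with z by ring.
    replace (f (z + c) * (1 - h (z + c)) + f z * h (z + c) - f z)%C
      with ((1 - h (z + c)) * (f (z + c) - f z))%C by ring.
    apply Hfin; try assumption. unfold h.
    replace ((z + c) / c)%C with (1 + z / c)%C by (field; exact Hc).
    now apply switch_iter_near_1.
Qed.

Theorem theorem6p4 (phi : C -> C) (Hphi : entire phi) :
  recurrent_comp phi <->
  exists a b : C, Cmod a = 1 /\ forall z : C, phi z = Cplus (Cmult a z) b.
Proof.
split.
- intros Hrec.
  destruct (injective_entire_affine phi Hphi (recurrent_injective phi Hphi Hrec))
    as [a [b [Ha Haff]]].
  exists a, b. split; [|exact Haff]. now apply (recurrent_affine_modulus phi a b).
- intros [a [b [Ha Haff]]].
  (* The map is the identity, a translation, or a rotation about its fixed point [b / (1 - a)]. *)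
  destruct (Ceq_dec a 1) as [->|Ha1].
  + destruct (Ceq_dec b 0) as [->|Hb].
    * apply (rotation_recurrent phi 1 0 Hphi Ha). intros z. rewrite Haff. ring.
    * apply (translation_recurrent phi b Hphi Hb). intros z. rewrite Haff. ring.
  + apply (rotation_recurrent phi a (b / (1 - a))%C Hphi Ha). intros z. rewrite Haff.
    assert (H : (1 - a)%C <> 0) by (apply Cminus_eq_contra; auto). field. exact H.
Qed.
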